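(* Let $S$ be a standard graded algebra over a field $k$. Suppose that $I\subset S$ is an ideal generated by forms of a single degree $d$, and $M$ is a finitely generated graded $S$-module, generated in a single degree, such that $M/IM$ has finite length. Let $e$ be the number such that $\operatorname{reg} I^mM = md+e$ for $m\gg 0$. Let $A=k[I_dt]$ with homogeneous maximal ideal $\mathfrak n$, and let $N_e=N_e(I,M)=k[I_dt]M_e$, regarded as a graded $A$-module. 1. The equality $\operatorname{reg} I^mM=md+e$ holds if $$m\ \ge\ \max\left\{\operatorname{reg} H^1_{\mathfrak n}(N_e)+1,\ \frac{\operatorname{reg} M-e+1}{d}\right\}.$$ 2. In case $\operatorname{reg} H^1_{\mathfrak n}(N_e)\ge (\operatorname{reg} M-e+1)/d$ and $m\ge 1$, the equality $\operatorname{reg} I^mM=md+e$ holds if and only if $$m\ \ge\ \operatorname{reg} H^1_{\mathfrak n}(N_e)+1.$$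
   Context: A standard graded algebra over a field $k$ is a graded $k$-algebra $S=\bigoplus_{j\ge 0}S_j$ with $S_0=k$ generated by finitely many forms of degree one. For an artinian graded module $H$, $\operatorname{reg} H=\max\{j\mid H_j\ne 0\}$ (with $\operatorname{reg} 0=-\infty$). For a finitely generated graded module $M$ over a standard graded algebra $S$ with homogeneous maximal ideal $S_+$, the Castelnuovo-Mumford regularity is $\operatorname{reg} M=\max_i\{\operatorname{reg} H^i_{S_+}(M)+i\}$. It is known that in the situation of the claim the difference $\operatorname{reg} I^mM-md$ is eventually constant in $m$ (as long as $I^mM\neq 0$ for all $m$); $e$ denotes this constant value. With $t$ an indeterminate, the Rees algebra is $S[It]=\bigoplus_{n\ge0}I^nt^n\subset S[t]$, and the Rees module is $S[It]M=\bigoplus_{n\ge 0}I^nM\,t^n\subset M\otimes_S S[t]$. Let $I_d$ be the degree $d$ part of $I$. The ring $A=k[I_dt]\subset S[It]$ is the $k$-subalgebra generated by $I_dt$; it is a standard graded $k$-algebra, graded by the power of $t$. For an integer $i$, $N_i(I,M)=k[I_dt]M_i=\bigoplus_{n\ge 0}(I_d)^nM_i\,t^n\subset S[It]M$, a finitely generated $A$-module graded by the power of $t$ (so it is generated in degree $0$). Local cohomology $H^1_{\mathfrak n}(N_e)$ is taken with this grading.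
   Formalization: Part 1 is stated for m ≥ 1: at m = 0 it is false, e.g. S = M = k[x,y], I = (x^d, y^d), d ≥ 2, where e = d−1, H^1(N_e) = 0 and the bound is ≤ 0, yet reg M = 0 ≠ e; for d > 0, m = 0 can meet the bound only if reg M < e. *)

(* Defs.v *)
From HB Require Import structures.
From mathcomp Require Import all_boot all_order all_algebra.
From mathcomp Require Import boolp classical_sets constructive_ereal ereal.

Set Implicit Arguments.
Unset Strict Implicit.
Unset Printing Implicit Defensive.

Import Order.TTheory GRing.Theory Num.Theory.
Local Open Scope classical_set_scope.
Local Open Scope ring_scope.

Definition additive_span (V : zmodType) (X : set V) : set V :=
  smallest (fun W : set V => GRing.zmod_closed (mem W)) X.

Definition submodule (R : comNzRingType) (V : lmodType R) (W : set V) : Prop :=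
  GRing.submod_closed (mem W).

Definition submodule_span (R : comNzRingType) (V : lmodType R) (X : set V) :
    set V :=
  smallest (@submodule R V) X.

Definition ideal_span (R : comNzRingType) (X : set R) : set R :=
  @submodule_span R R^o X.

(** [set_scale A W] is the product A W, i.e. all finite sums of [a *: w]. *)
Definition set_scale (R : comNzRingType) (V : lmodType R)
    (A : set R) (W : set V) : set V :=
  additive_span [set v | exists2 a, A a & exists2 w, W w & v = a *: w].

Definition ideal_pow (R : comNzRingType) (I : set R) (m : nat) : set R :=
  iter m (fun J => @set_scale R R^o I J) [set: R].

Definition subring_span (R : comNzRingType) (X : set R) : set R :=
  smallest (fun B : set R => GRing.subring_closed (mem B)) X.

(** The group V is the internal direct sum of the subgroups G i. *)
Record is_grading (J : choiceType) (V : zmodType) (G : J -> set V) : Prop := {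
  grading_zmod : forall i, GRing.zmod_closed (mem (G i));
  grading_sum : forall v, exists (s : seq J) (c : J -> V),
    (forall i, G i (c i)) /\ v = \sum_(i <- s) c i;
  grading_direct : forall (s : seq J) (c : J -> V),
    uniq s -> (forall i, G i (c i)) -> \sum_(i <- s) c i = 0 ->
    forall i, i \in s -> c i = 0
}.

Record standard_graded (k : fieldType) (S : comAlgType k) (G : nat -> set S) :
    Prop := {
  std_grading : is_grading G;
  std_mul : forall i j a b, G i a -> G j b -> G (i + j)%N (a * b);
  std_deg0 : G 0%N = range (fun c : k => c%:A);
  std_gen : exists xs : seq S, (forall x, x \in xs -> G 1%N x) /\
    subring_span (range (fun c : k => c%:A) `|` [set` xs]) = [set: S]
}.

Record graded_module (S : comNzRingType) (G : nat -> set S) (M : lmodType S)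
    (D : int -> set M) : Prop := {
  gmod_grading : is_grading D;
  gmod_scale : forall (i : nat) (j : int) a v,
    G i a -> D j v -> D (i%:Z + j) (a *: v)
}.

Definition finitely_generated (S : comNzRingType) (M : lmodType S) : Prop :=
  exists vs : seq M, submodule_span [set` vs] = [set: M].

Definition generated_in_single_degree (S : comNzRingType) (M : lmodType S)
    (D : int -> set M) : Prop :=
  exists g : int, submodule_span (D g) = [set: M].

(** The quotient M / W has a composition series; its terms are given by their
    preimages in M. *)
Definition finite_length_quotient (S : comNzRingType) (M : lmodType S)
    (W : set M) : Prop :=
  exists (n : nat) (C : nat -> set M),
    [/\ C 0%N = W, C n = [set: M],
        forall i, (i <= n)%N -> submodule (C i) &
        forall i, (i < n)%N -> C i `<` C i.+1 /\
          forall U, submodule U -> C i `<=` U -> U `<=` C i.+1 ->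
            U = C i \/ U = C i.+1].

(** The Cech complex, with respect to elements [xs] of degree one, of the graded
    module with homogeneous components [N j] (subgroups of V).  Its i-cochains
    of degree j are the families of elements of degree j of the localizations
    N_{x_s}, where s runs through the sets of i indices and x_s is the product
    of the [xs`_l], l in s.  As there are finitely many s, such a family can be
    written (c s / x_s ^ n)_s with a common exponent n, where c s has degree
    j + n i; it is represented by the pair (n, c). *)
Section Cech.
Variables (R : comNzRingType) (V : lmodType R) (N : int -> set V) (xs : seq R).
Local Notation r := (size xs).

Definition cech_den (s : {set 'I_r}) : R := \prod_(l in s) xs`_l.

(** u / x_s ^ n = u' / x_s ^ n' in the localization at x_s. *)
Definition frac_eq (s : {set 'I_r}) (n : nat) (u : V) (n' : nat) (u' : V) :
    Prop :=
  exists p : nat, cech_den s ^+ p *: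
    (cech_den s ^+ n' *: u - cech_den s ^+ n *: u') = 0.

Definition cech_cochain (i : nat) (j : int) (n : nat) (c : {set 'I_r} -> V) :
    Prop :=
  forall s : {set 'I_r}, #|s| = i -> N (j + (n * i)%N%:Z) (c s).

(** Numerators, over the denominators x_s ^ n, of the differential of
    (c s / x_s ^ n)_s: the restriction of c (s :\ l) / x_(s :\ l) ^ n to the
    localization at x_s is [xs`_l ^+ n *: c (s :\ l)] over x_s ^ n. *)
Definition cech_d (n : nat) (c : {set 'I_r} -> V) (s : {set 'I_r}) : V :=
  \sum_(l in s)
    ((-1) ^+ #|[set l' in s | (l' < l)%N]| * xs`_l ^+ n) *: c (s :\ l).

Definition cech_cocycle (i n : nat) (c : {set 'I_r} -> V) : Prop :=
  forall s : {set 'I_r}, #|s| = i.+1 -> frac_eq s n (cech_d n c s) 0 0.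

(** For i = 0 there are no (i-1)-cochains, and [cech_d n' b set0] is 0. *)
Definition cech_coboundary (i : nat) (j : int) (n : nat)
    (c : {set 'I_r} -> V) : Prop :=
  exists (n' : nat) (b : {set 'I_r} -> V),
    ((0 < i)%N -> cech_cochain i.-1 j n' b) /\
    forall s : {set 'I_r}, #|s| = i -> frac_eq s n' (cech_d n' b s) n (c s).

Definition cech_cohomology_neq0 (i : nat) (j : int) : Prop :=
  exists (n : nat) (c : {set 'I_r} -> V),
    [/\ cech_cochain i j n c, cech_cocycle i n c & ~ cech_coboundary i j n c].

End Cech.

(** Below, a graded ring is a graded subring of R, the direct sum of the [G n];
    its elements act on V, and a graded module over it is given by its
    homogeneous components [N j], subgroups of V. *)

Definition graded_total (R : comNzRingType) (G : nat -> set R) : set R :=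
  additive_span [set a | exists n, G n a].

Definition irrelevant_ideal (R : comNzRingType) (G : nat -> set R) : set R :=
  additive_span [set a | exists2 n, (0 < n)%N & G n a].

(** A finite system of generators of degree one of the irrelevant ideal; local
    cohomology does not depend on the choice. *)
Definition irrelevant_gens (R : comNzRingType) (G : nat -> set R) : seq R :=
  xget [::] [set xs | (forall x, x \in xs -> G 1%N x) /\
    @set_scale R R^o (graded_total G) [set` xs] = irrelevant_ideal G].

(** The degree j component of the i-th local cohomology of N with support in the
    irrelevant ideal of G is not zero. *)
Definition local_cohomology_neq0 (R : comNzRingType) (G : nat -> set R)
    (V : lmodType R) (N : int -> set V) (i : nat) (j : int) : Prop :=
  cech_cohomology_neq0 N (irrelevant_gens G) i j.

Definition reg_local_cohomology (R : comNzRingType) (G : nat -> set R)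
    (V : lmodType R) (N : int -> set V) (i : nat) : \bar rat :=
  ereal_sup [set (j%:~R)%:E | j in local_cohomology_neq0 G N i].

Definition reg (R : comNzRingType) (G : nat -> set R)
    (V : lmodType R) (N : int -> set V) : \bar rat :=
  ereal_sup (range (fun i : nat =>
    (reg_local_cohomology G N i + (i%:R)%:E)%E)).

(** The S[t]-module M[t], i.e. the tensor product of M and S[t] over S: the
    polynomials in t with coefficients in M. *)
Section PolyModule.
Variables (S : comNzRingType) (M : lmodType S).

Record poly_module := PolyModule {
  pm_coef :> nat -> M;
  pm_finite : exists n, forall i, (n <= i)%N -> pm_coef i = 0
}.

HB.instance Definition _ := gen_eqMixin poly_module.
HB.instance Definition _ := gen_choiceMixin poly_module.

Lemma pm_ext (u v : poly_module) : (forall i, u i = v i) -> u = v.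
Proof.
case: u v => [u Hu] [v Hv] /= e; have {}e : u = v by apply/funext.
by case: _ / e Hv => Hv; congr PolyModule; exact: Prop_irrelevance.
Qed.

Fact pm_zero_finite : exists n, forall i, (n <= i)%N -> (fun=> 0 : M) i = 0.
Proof. by exists 0%N. Qed.
Definition pm_zero := PolyModule pm_zero_finite.

Fact pm_opp_finite (u : poly_module) :
  exists n, forall i, (n <= i)%N -> (fun i => - u i) i = 0.
Proof.
by have [n un] := pm_finite u; exists n => i /un /= ->; rewrite oppr0.
Qed.
Definition pm_opp u := PolyModule (pm_opp_finite u).

Fact pm_add_finite (u v : poly_module) :
  exists n, forall i, (n <= i)%N -> (fun i => u i + v i) i = 0.
Proof.
have [n un] := pm_finite u; have [m vm] := pm_finite v.
exists (maxn n m) => i; rewrite geq_max => /andP[/un /= -> /vm /= ->].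
by rewrite addr0.
Qed.
Definition pm_add u v := PolyModule (pm_add_finite u v).

Fact pm_addA : associative pm_add.
Proof. by move=> u v w; apply: pm_ext => i /=; rewrite addrA. Qed.
Fact pm_addC : commutative pm_add.
Proof. by move=> u v; apply: pm_ext => i /=; rewrite addrC. Qed.
Fact pm_add0 : left_id pm_zero pm_add.
Proof. by move=> u; apply: pm_ext => i /=; rewrite add0r. Qed.
Fact pm_addN : left_inverse pm_zero pm_opp pm_add.
Proof. by move=> u; apply: pm_ext => i /=; rewrite addNr. Qed.

HB.instance Definition _ :=
  GRing.isZmodule.Build poly_module pm_addA pm_addC pm_add0 pm_addN.

Fact pm_scale_finite (p : {poly S}) (u : poly_module) :
  exists n, forall i, (n <= i)%N ->
    (fun i => \sum_(j < i.+1) p`_j *: u (i - j)%N) i = 0.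
Proof.
have [n un] := pm_finite u; exists (size p + n)%N => i lei /=.
apply: big1 => j _; have [lep|gtp] := leqP (size p) j.
  by rewrite nth_default ?scale0r.
rewrite un ?scaler0 // leq_subRL; last by rewrite -ltnS.
by apply: leq_trans lei; rewrite leq_add2r ltnW.
Qed.
Definition pm_scale p u := PolyModule (pm_scale_finite p u).

Fact pm_scaleA (p q : {poly S}) (w : poly_module) :
  pm_scale p (pm_scale q w) = pm_scale (p * q) w.
Proof.
apply: pm_ext => i /=.
pose coef3 j l := (p`_j * q`_(l - j)) *: w (i - l)%N.
transitivity (\sum_(j < i.+1) \sum_(l < i.+1 | (j <= l)%N) coef3 j l).
  apply: eq_bigr => j _; rewrite scaler_sumr.
  rewrite -(big_mkord (fun l => (j <= l)%N) (coef3 j)).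
  rewrite (@big_cat_nat _ _ _ j 0 i.+1) //=; last exact: ltnW.
  rewrite [X in _ = X + _]big_nat_cond [X in _ = X + _]big_pred0; last first.
    by move=> l; rewrite ltnNge andNb.
  rewrite add0r [RHS]big_nat_cond.
  rewrite [RHS](eq_bigl (fun l => (j <= l < i.+1)%N)); last first.
    by move=> l; rewrite andbAC andbb.
  rewrite -big_nat -(add0n (j : nat)) big_addn add0n.
  rewrite subSn; last by rewrite -ltnS.
  rewrite big_mkord.
  apply: eq_bigr => l _; rewrite /coef3 scalerA addnK; congr (_ *: w _).
  by rewrite addnC subnDA.
rewrite (exchange_big_dep predT) //=; apply: eq_bigr => l _.
rewrite coefM scaler_suml -(big_mkord (fun j => (j <= l)%N) (coef3^~ l)).
rewrite -(big_mkord xpredT (coef3^~ l)).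
by rewrite [RHS](big_nat_widen _ _ i.+1).
Qed.

Fact pm_scale1 : left_id 1 pm_scale.
Proof.
move=> u; apply: pm_ext => i /=.
rewrite big_ord_recl coef1 scale1r subn0 big1 ?addr0 // => j _.
by rewrite coef1 scale0r.
Qed.

Fact pm_scaleDr : right_distributive pm_scale +%R.
Proof.
move=> p u v; apply: pm_ext => i /=; rewrite -big_split /=.
by apply: eq_bigr => j _; rewrite scalerDr.
Qed.

Fact pm_scaleDl (u : poly_module) : {morph pm_scale^~ u : p q / p + q}.
Proof.
move=> p q; apply: pm_ext => i /=; rewrite -big_split /=.
by apply: eq_bigr => j _; rewrite coefD scalerDl.
Qed.

HB.instance Definition _ := GRing.Zmodule_isLmodule.Build {poly S} poly_module
  pm_scaleA pm_scale1 pm_scaleDr pm_scaleDl.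

(** The elements v t^n of M[t]; only 0 if n < 0. *)
Definition pm_homogeneous (n : int) : set poly_module :=
  [set u | forall l : nat, l%:Z != n -> u l = 0].

End PolyModule.

Section Rees.
Variables (k : fieldType) (S : comAlgType k) (G : nat -> set S).
Variables (M : lmodType S) (D : int -> set M).

(** The graded components of I^m M. *)
Definition power_module (I : set S) (m : nat) (j : int) : set M :=
  set_scale (ideal_pow I m) [set: M] `&` D j.

(** k[I_d t], as a subring of S[t]. *)
Definition fiber_ring (I : set S) (d : nat) : set {poly S} :=
  subring_span (range (fun c : k => (c%:A)%:P) `|`
                [set f *: 'X | f in I `&` G d]).

Definition fiber_ring_grading (I : set S) (d n : nat) : set {poly S} :=
  fiber_ring I d `&` [set p | forall l, l != n -> p`_l = 0].

(** The graded components of N_e(I, M) = k[I_d t] M_e, inside M[t]. *)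
Definition fiber_module (I : set S) (d : nat) (e n : int) :
    set (poly_module M) :=
  set_scale (fiber_ring I d)
    [set u : poly_module M | D e (u 0%N) /\ forall l, (0 < l)%N -> u l = 0]
  `&` pm_homogeneous n.

End Rees.

(* Main.v *)
Require Import Defs.
From mathcomp Require Import all_boot all_order all_algebra zify lra.
From mathcomp Require Import boolp classical_sets constructive_ereal ereal.

Set Implicit Arguments.
Unset Strict Implicit.
Unset Printing Implicit Defensive.
Import Order.TTheory GRing.Theory Num.Theory.
Local Open Scope ring_scope.

(** For [m >= 1] and [j] above the regularity of [M], the module [H^1(I^m M)_j] is
    [M_j / (I^m M)_j], while the other local cohomology of [I^m M] comes from [M].
    Since [(I^m M)_(m d + e) = I_d^m M_e] and [M] is generated in one degree,
    [reg I^m M <= m d + e] amounts to [M_(m d + e) = I_d^m M_e].  As [M / IM] has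
    finite length, [I_d] and [S_+] have the same radical modulo the annihilator of
    [M], so [H^1(N_e)_m] is also [M_(m d + e) / I_d^m M_e] in that range.  Finally
    [M_j = I_d^m M_(j - m d)] for all [j >= m d + a] with [m >= 1] implies the same
    for all [n >= m], so [reg I^m M < m d + e] would contradict the choice of [e].
    If [d = 0], then [I] is [0] or [S]. *)

(** * The Cech complex *)

(** The identification of H^1(I^m M)_j with M_j / (I^m M)_j is spoiled by H^0(M)_j, which may be
    nonzero in low degrees. The arguments therefore use [covers], equality up to torsion. It passes
    from [m] to larger exponents with no assumption on reg M. Torsion is discarded only in degrees n
    d + e with reg M <= n d + e - 1, which is what n >= (reg M - e + 1) / d says. In the second
    claim this inequality is not given for [m] itself. It is used at the largest n >= m with
    H^1(N_e)_n nonzero: that n is the top degree of H^1(N_e), so the hypothesis of the claim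
    supplies the inequality there. The cohomology of I^m M and that of N_e are computed from
    different elements, generators of S_+ and generators of the form f t. Only H^0 and H^1 have to
    be compared, and these have elementwise meanings, torsion and gluing, which are transferred by
    hand. *)

Lemma uniform_bound (T : finType) (Q : T -> nat -> Prop) :
  (forall t p q, (p <= q)%N -> Q t p -> Q t q) ->
  (forall t, exists p, Q t p) -> exists p, forall t, Q t p.
Proof.
move=> mono /choice[f hf]; exists (\max_t f t) => t.
by apply: mono (hf t); apply: leq_bigmax.
Qed.

Section Cech.
Variables (R : comNzRingType) (V : lmodType R) (xs : seq R).
Local Notation r := (size xs).
Local Notation set0 := finset.set0.
Implicit Types (N W : int -> set V) (s : {set 'I_r}) (c b : {set 'I_r} -> V).

Definition torsion (v : V) := forall l : 'I_r, exists p, xs`_l ^+ p *: v = 0.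

Lemma expZ_le0 (a : R) (v : V) p q : (p <= q)%N -> a ^+ p *: v = 0 -> a ^+ q *: v = 0.
Proof. by move=> pq e; rewrite -(subnK pq) exprD -scalerA e scaler0. Qed.

Lemma torsion_uniform (T : finType) (Q : pred T) (a : T -> R) (v : T -> V) :
  (forall t, Q t -> exists p, a t ^+ p *: v t = 0) ->
  exists p, forall t, Q t -> a t ^+ p *: v t = 0.
Proof.
move=> h; apply: (@uniform_bound T (fun t p => Q t -> a t ^+ p *: v t = 0)).
  by move=> t p q pq hp Qt; apply: expZ_le0 pq (hp Qt).
by move=> t; case: (boolP (Q t)) => [/h[p e]|_]; [exists p|exists 0%N].
Qed.

Lemma cech_denD1 s l : l \in s -> cech_den s = xs`_l * cech_den (s :\ l).
Proof. by move=> ls; rewrite /cech_den (big_setD1 l ls). Qed.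

Lemma cech_den_set0 : cech_den (set0 : {set 'I_r}) = 1.
Proof. by rewrite /cech_den big_set0. Qed.

Lemma cech_den_set1 (l : 'I_r) : cech_den [set l] = xs`_l.
Proof. by rewrite /cech_den big_set1. Qed.

Lemma cech_den_set2 (l l' : 'I_r) : l != l' -> cech_den [set l; l'] = xs`_l * xs`_l'.
Proof. by move=> ne; rewrite /cech_den big_setU1 ?big_set1 //= inE. Qed.

(** Over the denominators x_s^(n + p) this is the cochain given by [c] over x_s^n. Expanding is how
    numerators are moved into a smaller module. *)
Definition cech_expand (p : nat) c s : V := cech_den s ^+ p *: c s.

Lemma cech_d_expand n p c s :
  cech_d (n + p) (cech_expand p c) s = cech_den s ^+ p *: cech_d n c s.
Proof.
rewrite /cech_d scaler_sumr; apply: eq_bigr => l ls.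
rewrite (cech_denD1 ls) /cech_expand !scalerA; congr (_ *: _).
by rewrite exprMn exprD [RHS]mulrC -!mulrA.
Qed.

Definition stable N := forall j v (l : 'I_r), N j v -> N (j + 1) (xs`_l *: v).

Lemma stable_den N j v s : stable N -> N j v -> N (j + #|s|%:Z) (cech_den s *: v).
Proof.
move=> sN Nv; rewrite /cech_den cardE -big_enum.
elim: (enum s) => [|l e IH]; first by rewrite big_nil scale1r addr0.
by rewrite big_cons /= -addn1 PoszD addrA -scalerA; apply: sN.
Qed.

Lemma stable_den_exp N j v s p : stable N -> N j v ->
  N (j + (p * #|s|)%N%:Z) (cech_den s ^+ p *: v).
Proof.
move=> sN Nv; elim: p => [|p IH]; first by rewrite expr0 scale1r addr0.
by rewrite mulSn addnC PoszD addrA exprS -scalerA; apply: stable_den.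
Qed.

(** [W] agrees with [N] up to torsion: the localizations are the same. *)
Definition cofinal W N := [/\ stable W, forall j, (W j `<=` N j)%classic &
  forall j, exists p0, forall p v (l : 'I_r), (p0 <= p)%N -> N j v ->
    W (j + p%:Z) (xs`_l ^+ p *: v)].

(** One factor x_l^p0 of the expanding denominator carries the numerator into [W], and the other
    factors keep it there by stability. For [i = 0] there is no such factor. *)
Lemma cofinal_cochain W N i j n c : cofinal W N -> (0 < i)%N ->
  cech_cochain N i j n c -> exists p, cech_cochain W i j (n + p) (cech_expand p c).
Proof.
case=> sW WN ev i0 hc; have [p0 hp] := ev (j + (n * i)%N%:Z); exists p0 => s si.
have [l ls] : exists l, l \in s by apply/set0Pn; rewrite -card_gt0 si.
rewrite /cech_expand (cech_denD1 ls) exprMn mulrC -scalerA.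
have si' : #|s :\ l| = i.-1 by move: si; rewrite (cardsD1 l) ls => <-.
have := stable_den_exp (s :\ l) p0 sW (hp p0 (c s) l (leqnn _) (hc s si)).
rewrite si'; suff -> : j + ((n + p0) * i)%N%:Z =
  j + (n * i)%N%:Z + p0%:Z + (p0 * i.-1)%N%:Z by [].
by case: i i0 {hc hp si si'} => // i _ /=; rewrite -!addrA -!PoszD mulnDl (mulnS p0).
Qed.

Lemma cech_cochain_sub W N i j n c : (forall j, (W j `<=` N j)%classic) ->
  cech_cochain W i j n c -> cech_cochain N i j n c.
Proof. by move=> WN hc s /hc; apply: WN. Qed.

(** For [i > 1] a cochain of [N] that bounds a cocycle of [W] has positive degree, so it expands to
    a cochain of [W]. For [i = 1] it is a single element of [N] without denominator, and this is how
    M_j / (I^m M)_j enters H^1(I^m M). *)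
Lemma cech_cohomology_sub W N i j : cofinal W N -> (1 < i)%N ->
  cech_cohomology_neq0 W xs i j -> cech_cohomology_neq0 N xs i j.
Proof.
move=> co i1 [n [c [hc cc nb]]]; have [_ WN _] := co.
exists n, c; split=> //; first exact: cech_cochain_sub WN hc.
case=> n' [b [hb hs]]; apply: nb.
have i0 : (0 < i.-1)%N by case: i i1 {hc cc hb hs} => [|[]].
have [p hp] := cofinal_cochain co i0 (hb (ltnW i1)).
exists (n' + p)%N, (cech_expand p b); split=> // s /hs[q hq]; exists q.
rewrite cech_d_expand scalerA mulrC -scalerA exprD [cech_den s ^+ n' * _]mulrC -scalerA.
by rewrite -scalerBr scalerA mulrC -scalerA hq scaler0.
Qed.

(** Every cochain of positive degree of [N] expands to one of [W], so H^i(W) maps onto H^i(N). *)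
Lemma cech_cohomology_cofinal W N i j : cofinal W N -> (0 < i)%N ->
  cech_cohomology_neq0 N xs i j -> cech_cohomology_neq0 W xs i j.
Proof.
move=> co i0 [n [c [hc cc nb]]]; have [_ WN _] := co.
have [p hp] := cofinal_cochain co i0 hc.
exists (n + p)%N, (cech_expand p c); split=> //.
  move=> s /cc[q]; rewrite !scaler0 !subr0 => hq.
  exists q; rewrite cech_d_expand !scaler0 !subr0 expr0 scale1r.
  by rewrite expr0 scale1r in hq; rewrite scalerA mulrC -scalerA hq scaler0.
case=> n' [b [hb hs]]; apply: nb; exists n', b; split.
  by move=> i1; apply: cech_cochain_sub WN (hb i1).
move=> s /hs[q hq]; exists (q + p)%N; rewrite -hq exprD -scalerA; congr (_ *: _).
rewrite /cech_expand scalerBr !scalerA; congr (_ *: _ - _ *: _); last by rewrite mulrC.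
by rewrite exprD mulrC.
Qed.

Lemma cech_cohomology0P N j : cech_cohomology_neq0 N xs 0 j <->
  exists v, [/\ N j v, v != 0 & torsion v].
Proof.
split=> [[n [c [hc cc nb]]]|[v [Nv v0 tv]]].
- exists (c set0); split.
  + by have := hc set0 (cards0 _); rewrite muln0 addr0.
  + apply/eqP => c0; apply: nb; exists 0%N, (fun=> 0); split=> // s /cards0_eq ->.
    by exists 0%N; rewrite c0 /cech_d big_set0 !scaler0 subr0 scaler0.
  + move=> l; have [p] := cc [set l] (cards1 l).
    rewrite cech_den_set1 !scaler0 subr0 expr0 scale1r /cech_d big_set1 finset.setDv.
    rewrite (_ : [set l' in [set l] | _]%SET = set0); last first.
      by apply/setP => l'; rewrite !inE; case: eqP => // ->; rewrite ltnn.
    by rewrite cards0 expr0 mul1r scalerA -exprD; exists (p + n)%N.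
- exists 0%N, (fun=> v); split.
  + by move=> s _; rewrite mul0n addr0.
  + move=> s s1; rewrite /frac_eq !scaler0.
    have [l ->] : exists l, s = [set l] by apply/cards1P; rewrite s1.
    have [p hp] := tv l; exists p.
    by rewrite cech_den_set1 subr0 expr0 scale1r /cech_d big_set1 expr0 mulr1
      scalerA mulrC -scalerA hp scaler0.
  + case=> n' [b [_ hs]]; have [p] := hs set0 (cards0 _).
    rewrite cech_den_set0 !expr1n !scale1r /cech_d big_set0 sub0r => /eqP.
    by rewrite oppr_eq0 (negbTE v0).
Qed.

(** The vanishing of H^1 in degree [j]: sections u_l / x_l^n that agree on the overlaps come from
    one element of [N j]. *)
Definition glues N j := forall n (u : 'I_r -> V),
  (forall l, N (j + n%:Z) (u l)) ->
  (forall l l' : 'I_r, exists p,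
     (xs`_l * xs`_l') ^+ p *: (xs`_l ^+ n *: u l' - xs`_l' ^+ n *: u l) = 0) ->
  exists2 v, N j v & forall l : 'I_r, exists p, xs`_l ^+ p *: (xs`_l ^+ n *: v - u l) = 0.

Lemma cech_d_set2 n c (l l' : 'I_r) : (l < l')%N ->
  cech_d n c [set l; l'] = xs`_l ^+ n *: c [set l'] - xs`_l' ^+ n *: c [set l].
Proof.
move=> ll'; have ne : l != l' by rewrite -val_eqE /= ltn_eqF.
rewrite /cech_d big_setU1 ?big_set1 /=; last by rewrite inE.
have -> : [set l''  in [set l; l'] | (l'' < l)%N]%SET = set0.
  apply/setP => x; rewrite !inE; have [->|_] := eqVneq x l; first by rewrite ltnn.
  by have [->|_] := eqVneq x l' => //=; rewrite ltnNge ltnW.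
have -> : [set l''  in [set l; l'] | (l'' < l')%N]%SET = [set l].
  apply/setP => x; rewrite !inE; have [->|_] := eqVneq x l; first by rewrite ll'.
  by have [->|_] := eqVneq x l' => //=; rewrite ltnn.
rewrite cards0 cards1 expr0 expr1 mul1r mulN1r scaleNr.
have -> : [set l; l'] :\ l = [set l']%SET.
  by apply/setP => x; rewrite !inE; case: eqP => // ->; rewrite (negbTE ne).
have -> // : [set l; l'] :\ l' = [set l]%SET.
by apply/setP => x; rewrite !inE orbC; case: eqP => // ->; rewrite eq_sym (negbTE ne).
Qed.

Lemma cech_d_set1 n b (l : 'I_r) : cech_d n b [set l] = xs`_l ^+ n *: b set0.
Proof.
rewrite /cech_d big_set1 finset.setDv.
rewrite (_ : [set l' in [set l] | _]%SET = set0); last first.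
  by apply/setP => l'; rewrite !inE; case: eqP => // ->; rewrite ltnn.
by rewrite cards0 expr0 mul1r.
Qed.

Lemma cech_cohomology1P N j : ~ cech_cohomology_neq0 N xs 1 j <-> glues N j.
Proof.
split=> [h n u Nu cu|h [n [c [hc cc nb]]]].
- pose c s := if [pick l in s] is Some l then u l else 0.
  have c1 l : c [set l] = u l.
    by rewrite /c; case: pickP => [l' /[!inE]/eqP ->|/(_ l)] //; rewrite inE eqxx.
  have : cech_coboundary N 1 j n c.
    apply: contrapT => nb; apply: h; exists n, c; split=> //.
      by move=> s /eqP/cards1P[l ->]; rewrite muln1 c1.
    have hlt (l l' : 'I_r) : (l < l')%N -> frac_eq [set l; l'] n (cech_d n c [set l; l']) 0 0.
      move=> ll'; have [p hp] := cu l l'; exists p.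
      rewrite cech_den_set2; last by rewrite -val_eqE /= ltn_eqF.
      by rewrite scaler0 subr0 expr0 scale1r cech_d_set2 // !c1.
    move=> s /eqP/cards2P[l [l' [ne ->]]].
    have [/hlt //|/hlt|/val_inj e] := ltngtP l l'; last by rewrite e eqxx in ne.
    by rewrite finset.setUC.
  case=> n' [b [/(_ isT) hb hs]]; exists (b set0).
    by have := hb set0 (cards0 _); rewrite muln0 addr0.
  move=> l; have [p] := hs [set l] (cards1 l).
  rewrite cech_d_set1 c1 cech_den_set1 => hp; exists (p + n')%N; rewrite -hp exprD -scalerA.
  by congr (_ *: _); rewrite scalerBr !scalerA mulrC.
- have [|l l'|v Nv hv] := h n (fun l => c [set l]).
  + by move=> l; have := hc [set l] (cards1 l); rewrite muln1.
  + wlog ll' : l l' / (l < l')%N.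
      move=> hw; have [/hw //|/hw[p hp]|/val_inj ->] := ltngtP l l'; last first.
        by exists 0%N; rewrite subrr scaler0.
      by exists p; rewrite mulrC -opprB scalerN hp oppr0.
    have ne : l != l' by rewrite -val_eqE /= ltn_eqF.
    have := cc [set l; l']; rewrite cards2 ne => /(_ erefl)[p].
    by rewrite scaler0 subr0 expr0 scale1r cech_d_set2 // cech_den_set2 //; exists p.
  + apply: nb; exists 0%N, (fun=> v); split.
      by move=> _ s _; rewrite mul0n addr0.
    move=> s /eqP/cards1P[l ->]; have [p hp] := hv l; exists p.
    by rewrite cech_d_set1 cech_den_set1 !expr0 !scale1r.
Qed.

End Cech.

Local Open Scope classical_set_scope.
Local Open Scope ring_scope.

(** * Subgroups and submodules given as sets *)

Section Subgroups.
Variable V : zmodType.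

Definition subgroup (W : set V) := W 0 /\ forall u v, W u -> W v -> W (u - v).

Lemma zmod_closedP (W : set V) : GRing.zmod_closed (mem W) <-> subgroup W.
Proof.
split=> [[w0 wB]|[w0 wB]]; split.
- by move: w0; rewrite inE.
- by move=> u v Wu Wv; have := wB u v; rewrite !inE; exact.
- by rewrite inE.
- by move=> u v; rewrite !inE; apply: wB.
Qed.

Section Closure.
Variables (W : set V) (hW : subgroup W).

Lemma subgroup0 : W 0. Proof. by case: hW. Qed.

Lemma subgroupB u v : W u -> W v -> W (u - v). Proof. by case: hW => _; apply. Qed.

Lemma subgroupN u : W u -> W (- u).
Proof. by move=> Wu; rewrite -sub0r; apply: subgroupB => //; apply: subgroup0. Qed.

Lemma subgroupD u v : W u -> W v -> W (u + v).
Proof. by move=> Wu Wv; rewrite -[v]opprK; apply/subgroupB/subgroupN. Qed.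

Lemma subgroup_sum (J : Type) (s : seq J) (P : pred J) (F : J -> V) :
  (forall i, P i -> W (F i)) -> W (\sum_(i <- s | P i) F i).
Proof. by move=> hF; apply: big_ind; [apply: subgroup0|apply: subgroupD|]. Qed.

End Closure.

Lemma additive_span_subgroup (X : set V) : subgroup (additive_span X).
Proof.
split=> [W [/zmod_closedP[W0 _] _] //|u v hu hv W [cW XW]].
have /zmod_closedP[_] := cW; apply; [exact: hu | exact: hv].
Qed.

Lemma sub_additive_span (X : set V) : X `<=` additive_span X.
Proof. by move=> x Xx W [_]; apply. Qed.

Lemma additive_span_sub (X W : set V) :
  subgroup W -> X `<=` W -> additive_span X `<=` W.
Proof. by move=> /zmod_closedP hW XW; apply: smallest_sub. Qed.

Lemma subgroupI (W W' : set V) : subgroup W -> subgroup W' -> subgroup (W `&` W').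
Proof.
move=> hW hW'; split; first by split; apply: subgroup0.
by move=> u v [Wu Wu'] [Wv Wv']; split; apply: subgroupB.
Qed.

Lemma subgroup_add (W W' : set V) : subgroup W -> subgroup W' ->
  subgroup [set v | exists2 u, W u & exists2 u', W' u' & v = u + u'].
Proof.
move=> hW hW'; split.
  by exists 0; [apply: subgroup0|exists 0; [apply: subgroup0|rewrite addr0]].
move=> _ _ [u Wu [u' Wu' ->]] [v Wv [v' Wv' ->]].
exists (u - v); first exact: subgroupB.
by exists (u' - v'); [apply: subgroupB|rewrite opprD addrACA].
Qed.

End Subgroups.

Lemma subgroup_preim (V V' : zmodType) (f : V -> V') (W : set V') :
  zmod_morphism f -> subgroup W -> subgroup (f @^-1` W).
Proof.
move=> fB hW; split; first by rewrite /preimage /= -(subrr 0) fB subrr; apply: subgroup0.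
by move=> u v hu hv; rewrite /preimage /= fB; apply: subgroupB.
Qed.

Section Submodules.
Variables (R : comNzRingType) (V : lmodType R).

Lemma submoduleP (W : set V) :
  submodule W <-> subgroup W /\ forall a v, W v -> W (a *: v).
Proof.
split=> [[w0 wZ]|[hW wZ]].
  have {w0 wZ}[w0 wZ]: W 0 /\ forall a u v, W u -> W v -> W (a *: u + v).
    split; first by move: w0; rewrite inE.
    by move=> a u v Wu Wv; have := wZ a u v; rewrite !inE; exact.
  split; last by move=> a v Wv; rewrite -[_ *: _]addr0; apply: wZ.
  by split=> // u v Wu Wv; rewrite addrC -scaleN1r; apply: wZ.
split; first by rewrite inE; apply: subgroup0.
by move=> a u v; rewrite !inE => Wu Wv; apply: subgroupD => //; apply: wZ.
Qed.

Lemma submodule_subgroup (W : set V) : submodule W -> subgroup W.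
Proof. by case/submoduleP. Qed.

Lemma submoduleZ (W : set V) a v : submodule W -> W v -> W (a *: v).
Proof. by case/submoduleP => _; apply. Qed.

End Submodules.

Section Submodules.
Variables (R : comNzRingType) (V : lmodType R).

Lemma submodule_span_submodule (X : set V) : submodule (submodule_span X).
Proof.
apply/submoduleP; split; first split.
- by move=> W [/submoduleP[hW _] _]; apply: subgroup0.
- move=> u v hu hv W [sW XW]; have /submoduleP[hW _] := sW.
  by apply: subgroupB => //; [exact: hu | exact: hv].
- by move=> a v hv W [sW XW]; apply: submoduleZ => //; exact: hv.
Qed.

Lemma sub_submodule_span (X : set V) : X `<=` submodule_span X.
Proof. by move=> x Xx W [_]; apply. Qed.

Lemma submodule_span_sub (X W : set V) :
  submodule W -> X `<=` W -> submodule_span X `<=` W.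
Proof. exact: smallest_sub. Qed.

Lemma set_scale_subgroup (A : set R) (W : set V) : subgroup (set_scale A W).
Proof. exact: additive_span_subgroup. Qed.

Lemma set_scaleI (A : set R) (W : set V) a w : A a -> W w -> set_scale A W (a *: w).
Proof. by move=> Aa Ww; apply: sub_additive_span; exists a => //; exists w. Qed.

Lemma set_scale_sub (A : set R) (W U : set V) : subgroup U ->
  (forall a w, A a -> W w -> U (a *: w)) -> set_scale A W `<=` U.
Proof.
by move=> hU h; apply: additive_span_sub => // _ [a Aa [w Ww ->]]; apply: h.
Qed.

Lemma scaler_zmod_morphism (a : R) : zmod_morphism (fun v : V => a *: v).
Proof. by move=> u v; rewrite scalerBr. Qed.

Lemma scalel_zmod_morphism (v : V) : zmod_morphism (fun a : R => a *: v).
Proof. by move=> a b; rewrite scalerBl. Qed.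

Lemma set_scale_submodule (A : set R) (W : set V) :
  submodule W -> submodule (set_scale A W).
Proof.
move=> sW; apply/submoduleP; split; first exact: set_scale_subgroup.
move=> a v; move: v; apply: set_scale_sub.
  apply: (@subgroup_preim _ _ (fun v : V => a *: v)); first exact: scaler_zmod_morphism.
  exact: set_scale_subgroup.
move=> b w Ab Ww; rewrite scalerA mulrC -scalerA.
by apply: set_scaleI => //; apply: submoduleZ.
Qed.

Lemma set_scale_submodulel (A : set R^o) (W : set V) :
  submodule A -> submodule (set_scale A W).
Proof.
move=> sA; apply/submoduleP; split; first exact: set_scale_subgroup.
move=> a v; move: v; apply: set_scale_sub.
  apply: (@subgroup_preim _ _ (fun v : V => a *: v)); first exact: scaler_zmod_morphism.
  exact: set_scale_subgroup.
move=> b w Ab Ww; rewrite scalerA.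
apply: set_scaleI => //; exact: (@submoduleZ R R^o A a b sA Ab).
Qed.

Lemma submoduleT : submodule [set: V].
Proof. exact/submoduleP. Qed.

End Submodules.


(** * Homogeneous components *)

Lemma zmod_morphism_sum (V V' : zmodType) (f : V -> V') : zmod_morphism f ->
  forall (J : Type) (s : seq J) (P : pred J) (F : J -> V),
  f (\sum_(i <- s | P i) F i) = \sum_(i <- s | P i) f (F i).
Proof.
move=> fB; have f0 : f 0 = 0 by rewrite -[X in f X](subrr 0) fB subrr.
have fD u v : f (u + v) = f u + f v.
  by rewrite -[v in LHS]opprK fB -[- v]sub0r fB f0 sub0r opprK.
by move=> J s P F; apply: (big_morph f fD f0).
Qed.

Lemma big_support (J : eqType) (V : nmodType) (s u : seq J) (F : J -> V) :
  uniq s -> uniq u -> {subset s <= u} -> (forall j, j \notin s -> F j = 0) ->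
  \sum_(j <- s) F j = \sum_(j <- u) F j.
Proof.
move=> us uu su F0; rewrite [RHS](bigID (mem s)) /= [X in _ + X]big1 // addr0.
rewrite -[RHS]big_filter; apply: perm_big; apply: uniq_perm; rewrite ?filter_uniq //.
by move=> j; rewrite mem_filter /=; case: (boolP (j \in s)) => // /su ->.
Qed.

Section Components.
Variables (J : choiceType) (V : zmodType) (G : J -> set V) (hG : is_grading G).

Lemma grading_subgroup i : subgroup (G i).
Proof. exact/zmod_closedP/grading_zmod. Qed.

(** The list given by [grading_sum] may repeat an index, so [c j] has to be counted once for each
    occurrence. *)
Definition component (j : J) (v : V) : V :=
  let: exist s sc := cid (grading_sum hG v) in
  let: exist c _ := cid sc in c j *+ count_mem j s.

Lemma component_sum v : exists s : seq J, [/\ uniq s, forall i, i \notin s -> component i v = 0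
  & v = \sum_(i <- s) component i v].
Proof.
rewrite /component; case: cid => s sc; case: cid => c [cG vE].
exists (undup s); split; first exact: undup_uniq.
  by move=> i; rewrite mem_undup => /count_memPn ->.
by rewrite [LHS]vE -big_undup_iterop_count.
Qed.

Lemma component_in i v : G i (component i v).
Proof.
rewrite /component; case: cid => s sc; case: cid => c [cG vE].
have hGi := grading_subgroup i; elim: (count _ _) => [|n IH].
  by rewrite mulr0n; apply: subgroup0.
by rewrite mulrS; apply: subgroupD.
Qed.

Lemma component_unique (s : seq J) (c : J -> V) v : uniq s ->
  (forall i, G i (c i)) -> (forall i, i \notin s -> c i = 0) ->
  v = \sum_(i <- s) c i -> forall i, component i v = c i.
Proof.
move=> us cG c0 vE i; have [t [ut t0 vEt]] := component_sum v.
pose u := undup (s ++ t).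
have uu : uniq u := undup_uniq _.
have /eqP : \sum_(j <- u) (component j v - c j) = 0.
  rewrite big_split /= sumrN -(big_support ut) //; last first.
    by move=> j jt; rewrite mem_undup mem_cat jt orbT.
  rewrite -vEt -(big_support us) // -?vE ?subrr // => j js.
  by rewrite mem_undup mem_cat js.
move=> /eqP /(grading_direct hG uu) h.
have [iu|] := boolP (i \in u).
  by apply/eqP; rewrite -subr_eq0 h // => j; apply: subgroupB (component_in _ _) (cG j);
    apply: grading_subgroup.
by rewrite mem_undup mem_cat negb_or => /andP[is_ it]; rewrite c0 // t0.
Qed.

Lemma component_homog i j v : G i v -> component j v = if j == i then v else 0.
Proof.
move=> Gv; apply: (@component_unique [:: i] (fun j => if j == i then v else 0)) => //.
- move=> l; case: eqP => [->|_] //; exact: subgroup0 (grading_subgroup l).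
- by move=> l; rewrite inE => /negbTE ->.
- by rewrite big_seq1 eqxx.
Qed.

Lemma component_id i v : G i v -> component i v = v.
Proof. by move=> /(@component_homog _ i); rewrite eqxx. Qed.

Lemma component_zmod_morphism i : zmod_morphism (component i).
Proof.
move=> u v; have [s [us s0 uE]] := component_sum u; have [t [ut t0 vE]] := component_sum v.
pose w := undup (s ++ t); have uw : uniq w := undup_uniq _.
apply: (@component_unique w (fun j => component j u - component j v)).
- by [].
- by move=> j; apply: subgroupB (component_in _ _) (component_in _ _); apply: grading_subgroup.
- by move=> j; rewrite mem_undup mem_cat negb_or => /andP[js jt]; rewrite s0 // t0 // subrr.
- rewrite big_split /= sumrN -(big_support us) //; last by move=> j js; rewrite mem_undup mem_cat js.
  rewrite -uE -(big_support ut) // -?vE // => j js.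
  by rewrite mem_undup mem_cat js orbT.
Qed.

Lemma component0 i : component i 0 = 0.
Proof. by rewrite -[X in component i X](subrr 0) component_zmod_morphism subrr. Qed.

End Components.

Section Shift.
Variables (J J' : choiceType) (V V' : zmodType) (G : J -> set V) (G' : J' -> set V').
Variables (hG : is_grading G) (hG' : is_grading G') (f : V -> V') (sh : J -> J').
Hypotheses (fB : zmod_morphism f).
Hypothesis fG : forall i v, G i v -> G' (sh i) (f v).

Let f0 : f 0 = 0. Proof. by rewrite -[X in f X](subrr 0) fB subrr. Qed.

(** Injectivity of the shift ensures that a single component of [v] contributes to degree [sh i]. It
    is applied to multiplication by a homogeneous scalar and to the action on a homogeneous
    vector. *)
Lemma component_image i v : injective sh ->
  component hG' (sh i) (f v) = f (component hG i v).
Proof.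
move=> shI; have [s [us s0 vE]] := component_sum hG v.
rewrite [in LHS]vE !zmod_morphism_sum //; last exact: component_zmod_morphism.
under eq_bigr => j _ do
  rewrite (component_homog hG' _ (fG (component_in hG j v))) (inj_eq shI).
have [is_|/s0 i0] := boolP (i \in s).
  rewrite (bigD1_seq i) //= eqxx big1 ?addr0 // => j ji.
  by rewrite eq_sym (negbTE ji).
by rewrite i0 f0 big1 // => j _; case: eqP => // <-; rewrite i0.
Qed.

Lemma component_out j v : (forall i, sh i != j) -> component hG' j (f v) = 0.
Proof.
move=> hj; have [s [us s0 vE]] := component_sum hG v.
rewrite [in LHS]vE !zmod_morphism_sum //; last exact: component_zmod_morphism.
apply: big1 => i _; rewrite (component_homog hG' _ (fG (component_in hG i v))).
by rewrite eq_sym (negbTE (hj i)).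
Qed.

End Shift.

(** * Generators of the irrelevant ideals *)

Section LinearSpan.
Variables (k : fieldType) (V : lmodType k).

Definition linear_subspace (W : set V) := subgroup W /\ forall (c : k) v, W v -> W (c *: v).

Fixpoint lspan (gs : seq V) : set V :=
  if gs is g :: gs' then [set v | exists c : k, exists2 w, lspan gs' w & v = c *: g + w]
  else [set 0].

Lemma lspan_subspace gs : linear_subspace (lspan gs).
Proof.
elim: gs => [|g gs [IH IHZ]].
  by split; [split=> // u v -> ->; rewrite subrr|move=> c v ->; rewrite scaler0].
split; first split.
- by exists 0, 0; [apply: subgroup0|rewrite scale0r addr0].
- move=> _ _ [c [u hu ->]] [c' [u' hu' ->]]; exists (c - c'), (u - u').
    exact: subgroupB.
  by rewrite scalerBl opprD addrACA.
- move=> a _ [c [u hu ->]]; exists (a * c), (a *: u); first exact: IHZ.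
  by rewrite scalerDr scalerA.
Qed.

Lemma lspan_sub (W : set V) gs : linear_subspace W -> {in gs, forall g, W g} -> lspan gs `<=` W.
Proof.
move=> [hW WZ]; elim: gs => [_ _ ->|g gs IH h v /= [c [w hw ->]]]; first exact: subgroup0.
apply: subgroupD => //; first by apply/WZ/h; rewrite inE eqxx.
by apply: IH => // x xgs; apply: h; rewrite inE xgs orbT.
Qed.

Lemma lspan_mem gs g : g \in gs -> lspan gs g.
Proof.
elim: gs => // a gs IH; rewrite inE => /orP[/eqP ->|/IH h].
  by exists 1, 0; rewrite ?scale1r ?addr0 //; case: (lspan_subspace gs) => /subgroup0.
by exists 0, g => //; rewrite scale0r add0r.
Qed.

(** Induction on [gs]: if some [w] in [W] involves the first vector, subtracting a multiple of [w]
    moves any element of [W] into the span of the others. This gives I_d a finite basis, hence the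
    irrelevant ideal of k[I_d t] finitely many generators. *)
Lemma subspace_finitely_spanned (W : set V) gs : linear_subspace W -> W `<=` lspan gs ->
  exists2 fs, {in fs, forall f, W f} & W `<=` lspan fs.
Proof.
elim: gs W => [|g gs IH] W [hW WZ] Wsp; first by exists [::].
have [hs hsZ] := lspan_subspace gs.
have [|fs fsW Wfs] := IH (W `&` lspan gs) _ (@subIsetr _ _ _).
  split; first exact: subgroupI.
  by move=> c v [Wv sv]; split; [apply: WZ|apply: hsZ].
have [hf hfZ] := lspan_subspace fs.
have [sub|] := pselect (W `<=` lspan gs).
  by exists fs => [f /fsW[]|v Wv] //; apply: Wfs; split=> //; apply: sub.
move=> /existsNP[w /not_implyP[Ww nw]].
exists (w :: fs) => [f|v Wv]; first by rewrite inE => /orP[/eqP ->|/fsW[]].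
have [c [u hu wE]] := Wsp _ Ww; have [c' [u' hu' vE]] := Wsp _ Wv.
have c0 : c != 0.
  by apply: contra_notN nw => /eqP c0; rewrite wE c0 scale0r add0r.
exists (c' / c), (v - (c' / c) *: w); last by rewrite addrC subrK.
apply: Wfs; split; first by apply: subgroupB => //; apply: WZ.
rewrite vE wE scalerDr scalerA divfK // opprD addrACA subrr add0r.
by apply: subgroupB => //; apply: hsZ.
Qed.

End LinearSpan.

Section Monomials.
Variables (k : fieldType) (S : comAlgType k).

Definition scalars : set S := range (fun c : k => c%:A).

(** For X = I_d this is I_d^n, the set of coefficients of t^n in k[I_d t]. *)
Definition monomial_span (X : set S) (n : nat) : set S :=
  iter n (@set_scale S S^o X) scalars.

Lemma mulr_zmod_morphism (a : S) : zmod_morphism (fun b : S => b * a).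
Proof. by move=> u v; rewrite mulrBl. Qed.

Lemma mull_zmod_morphism (a : S) : zmod_morphism (fun b : S => a * b).
Proof. by move=> u v; rewrite mulrBr. Qed.

Lemma scalars_subgroup : subgroup scalars.
Proof.
split; first by exists 0; rewrite ?scale0r.
by move=> _ _ [c _ <-] [c' _ <-]; exists (c - c'); rewrite ?scalerBl.
Qed.

Variable X : set S.

Lemma monomial_span_subgroup n : subgroup (monomial_span X n).
Proof. by case: n => [|n]; [exact: scalars_subgroup|exact: set_scale_subgroup]. Qed.

Lemma monomial_spanM m n a b : monomial_span X m a -> monomial_span X n b ->
  monomial_span X (m + n) (a * b).
Proof.
elim: m a => [a [c _ <-] hb|m IH a].
  rewrite add0n mulr_algl; elim: n b hb => [_ [c' _ <-]|n IH].
    by exists (c * c') => //; rewrite scalerA.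
  apply: (@set_scale_sub S S^o _ _ [set b | monomial_span X n.+1 (c *: b)]).
    apply: (@subgroup_preim S S (fun b : S => c *: b) (monomial_span X n.+1)).
      by move=> u v; rewrite scalerBr.
    exact: set_scale_subgroup.
  move=> x w Xx hw; rewrite /preimage /= scalerAr.
  by apply: (@set_scaleI S S^o) => //; apply: IH.
move=> ha; move: a ha.
apply: (@set_scale_sub S S^o _ _
  [set a | monomial_span X n b -> monomial_span X (m.+1 + n) (a * b)]).
  split=> [hb|u v hu hv hb]; rewrite ?mul0r ?mulrBl.
    exact: subgroup0 (monomial_span_subgroup _).
  by apply: subgroupB (hu hb) (hv hb); apply: monomial_span_subgroup.
move=> x w Xx hw hb; rewrite /= -mulrA.
by apply: (@set_scaleI S S^o) => //; apply: IH.
Qed.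

Lemma monomial_span_subspace n : linear_subspace (monomial_span X n).
Proof.
split; first exact: monomial_span_subgroup.
by move=> c v hv; rewrite -mulr_algl; apply: (@monomial_spanM 0) => //; exists c.
Qed.

Lemma monomial_span1 x : X x -> monomial_span X 1 x.
Proof.
move=> Xx; rewrite -[x]mulr1; apply: (@set_scaleI S S^o) => //.
by exists 1; rewrite ?scale1r.
Qed.

Lemma monomial_span_finite (xs : seq S) : X = [set` xs] ->
  forall n, exists gs, monomial_span X n `<=` lspan gs.
Proof.
move=> XE; elim=> [|n [gs IH]].
  exists [:: 1] => _ [c _ <-]; exists c, 0; rewrite ?addr0 //.
exists [seq x * g | x <- xs, g <- gs].
apply: (@set_scale_sub S S^o X (monomial_span X n)).
  by case: (lspan_subspace [seq x * g | x <- xs, g <- gs]).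
move=> x w; rewrite {1}XE => /= xxs /IH hw.
have [hl hlZ] := lspan_subspace [seq x * g | x <- xs, g <- gs].
suff : lspan gs `<=` (fun b => lspan [seq x * g | x <- xs, g <- gs] (x * b)) by apply.
apply: lspan_sub.
  split; first exact: (subgroup_preim (@mull_zmod_morphism x)).
  by move=> c v hv; rewrite -scalerAr; apply: hlZ.
by move=> g ggs; apply: lspan_mem; apply: allpairs_f.
Qed.

End Monomials.

Lemma subring_span_sub (R : comNzRingType) (X B : set R) : B 1 -> subgroup B ->
  (forall a b, B a -> B b -> B (a * b)) -> X `<=` B -> subring_span X `<=` B.
Proof.
move=> B1 [B0 BB] BM XB; apply: smallest_sub => //; split.
- by rewrite inE.
- by move=> u v; rewrite !inE; apply: BB.
- by move=> u v; rewrite !inE; apply: BM.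
Qed.

Lemma subring_span_closed (R : comNzRingType) (X : set R) :
  [/\ subring_span X 1, subgroup (subring_span X), (forall a b, subring_span X a ->
    subring_span X b -> subring_span X (a * b)) & X `<=` subring_span X].
Proof.
have st (B : set R) : GRing.subring_closed (mem B) ->
    [/\ B 1, forall u v, B u -> B v -> B (u - v) & forall u v, B u -> B v -> B (u * v)].
  case=> B1 BB BM; split; first by move: B1; rewrite inE.
    by move=> u v Bu Bv; have := BB u v; rewrite !inE; exact.
  by move=> u v Bu Bv; have := BM u v; rewrite !inE; exact.
split.
- by move=> B [/st[]].
- split; first by move=> B [/st[B1 BB _] _]; rewrite -(subrr 1); apply: BB.
  by move=> u v hu hv B [cB XB]; case: (st B cB) => _ BB _; apply: BB; [apply: hu|apply: hv].
- by move=> u v hu hv B [cB XB]; case: (st B cB) => _ _ BM; apply: BM; [apply: hu|apply: hv].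
- by move=> x Xx B [_]; apply.
Qed.

Section StandardGraded.
Variables (k : fieldType) (S : comAlgType k) (G : nat -> set S).
Hypothesis hS : standard_graded G.
Let hG := std_grading hS.

Lemma graded_scalar (c : k) : G 0%N c%:A.
Proof. by rewrite (std_deg0 hS); exists c. Qed.

Lemma graded_exp i a n : G i a -> G (n * i)%N (a ^+ n).
Proof.
move=> Ga; elim: n => [|n IH]; first by rewrite expr0 -(scale1r 1); apply: graded_scalar.
by rewrite exprS mulSn; apply: std_mul.
Qed.

Lemma graded_scale i (c : k) a : G i a -> G i (c *: a).
Proof. by move=> Ga; rewrite -mulr_algl -(add0n i); apply: std_mul => //; apply: graded_scalar. Qed.

Lemma graded_total_setT : graded_total G = [set: S].
Proof.
apply/seteqP; split=> // a _; have [s [_ _ ->]] := component_sum hG a.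
apply: subgroup_sum => [|i _]; first exact: additive_span_subgroup.
by apply: sub_additive_span; exists i; apply: component_in.
Qed.

(** The elements all of whose components are combinations of monomials of the right degree form a
    subring that contains the generators of [S]. *)
Lemma graded_monomial_span (xs : seq S) : (forall x, x \in xs -> G 1%N x) ->
  subring_span (range (fun c : k => c%:A) `|` [set` xs]) = [set: S] ->
  forall n, G n `<=` monomial_span [set` xs] n.
Proof.
move=> xs1 gen n a Ga.
pose B : set S := [set b | forall n, monomial_span [set` xs] n (component hG n b)].
suff : B a by move/(_ n); rewrite component_id.
have hE := monomial_span_subgroup [set` xs].
have BG i b : G i b -> monomial_span [set` xs] i b -> B b.
  move=> Gb hb j; rewrite (component_homog hG _ Gb).
  by case: eqP => [->|_] //; apply: subgroup0.
have hB : subgroup B.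
  split=> [j|u v hu hv j]; first by rewrite component0; apply: subgroup0.
  by rewrite component_zmod_morphism; apply: subgroupB.
suff : subring_span (range (fun c : k => c%:A) `|` [set` xs]) `<=` B by apply; rewrite gen.
apply: subring_span_sub => //.
- apply: (@BG 0%N); first by rewrite -(scale1r 1); apply: graded_scalar.
  by exists 1; rewrite ?scale1r.
- move=> u v hu hv; have [s [_ _ ->]] := component_sum hG u.
  have [t [_ _ ->]] := component_sum hG v.
  rewrite mulr_suml; apply: subgroup_sum => // i _; rewrite mulr_sumr.
  apply: subgroup_sum => // j _; apply: (@BG (i + j)%N).
    by apply: (std_mul hS); apply: component_in.
  exact: monomial_spanM.
- move=> x [[c _ <-]|/= xxs].
    by apply: (@BG 0%N); [apply: graded_scalar|exists c].
  by apply: (@BG 1%N); [apply: xs1|apply: monomial_span1].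
Qed.

Lemma graded_finitely_spanned n : exists gs, G n `<=` lspan gs.
Proof.
have [xs [xs1 gen]] := std_gen hS.
have [gs hgs] := monomial_span_finite (erefl [set` xs]) n.
by exists gs => a /(graded_monomial_span xs1 gen) /hgs.
Qed.

(** [irrelevant_gens] is a choice with a default value. Algebra generators of degree one form an
    admissible system, so the chosen one has the required properties. *)
Lemma standard_irrelevant_gens :
  (forall x, x \in irrelevant_gens G -> G 1%N x) /\
  @set_scale S S^o [set: S] [set` irrelevant_gens G] = irrelevant_ideal G.
Proof.
rewrite -graded_total_setT /irrelevant_gens; case: xgetP => [xs _ //|noxs].
have [xs [xs1 gen]] := std_gen hS; case: (noxs xs); split=> //.
rewrite graded_total_setT; apply/seteqP; split.
  apply: set_scale_sub => [|a x _ /= xxs]; first exact: additive_span_subgroup.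
  have [s [_ _ ->]] := component_sum hG a; rewrite scaler_suml.
  apply: subgroup_sum => [|i _]; first exact: additive_span_subgroup.
  apply: sub_additive_span; exists (i + 1)%N; first by rewrite addn1.
  by apply: (std_mul hS) (xs1 x xxs); apply: component_in.
apply: additive_span_sub; first exact: set_scale_subgroup.
move=> a [[//|n] _ /(graded_monomial_span xs1 gen)].
move: a; apply: (@set_scale_sub S S^o _ _ _ (set_scale_subgroup _ _)).
move=> x b /= xxs _; rewrite /GRing.scale /= mulrC.
exact: (@set_scaleI S S^o).
Qed.

(** An element of S_(n+1) is a combination of the generators with arbitrary coefficients; taking its
    component of degree n + 1 replaces each coefficient by its component of degree n. *)
Lemma graded_succ n : G n.+1 `<=` @set_scale S S^o [set` irrelevant_gens G] (G n).
Proof.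
move=> a Ga; have [xs1 E] := standard_irrelevant_gens.
have : irrelevant_ideal G a by apply: sub_additive_span; exists n.+1.
rewrite -E => ha; rewrite -(component_id hG Ga); move: a {Ga} ha.
set T := set_scale [set` _] _.
apply: (@set_scale_sub S S^o _ _ (component hG n.+1 @^-1` T)).
  apply: subgroup_preim (set_scale_subgroup _ _); exact: component_zmod_morphism.
move=> b x _ /= xxs; rewrite /preimage /= {1}/GRing.scale /=.
rewrite -addn1 (@component_image _ _ _ _ _ _ hG hG (fun b => b * x) (fun i => i + 1)%N) //.
- by rewrite mulrC; apply: (@set_scaleI S S^o) => //; apply: component_in.
- exact: mulr_zmod_morphism.
- by move=> i c Gc; apply: (std_mul hS) => //; apply: xs1.
- exact: addIn.
Qed.

End StandardGraded.

(** * Powers of the ideal and the fiber module *)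

Lemma set_scaleS (R : comNzRingType) (V : lmodType R) (A B : set R) (W U : set V) :
  A `<=` B -> W `<=` U -> set_scale A W `<=` set_scale B U.
Proof.
move=> AB WU; apply: set_scale_sub; first exact: set_scale_subgroup.
by move=> a w /AB Ba /WU Uw; apply: set_scaleI.
Qed.

Lemma set_scaleA (R : comNzRingType) (V : lmodType R) (A B : set R) (W : set V) :
  set_scale (@set_scale R R^o A B) W = set_scale A (set_scale B W).
Proof.
apply/seteqP; split.
  apply: set_scale_sub => [|c w hc Ww]; first exact: set_scale_subgroup.
  move: c hc; apply: (@set_scale_sub R R^o _ _
    [set c | set_scale A (set_scale B W) (c *: w)]).
    apply: (@subgroup_preim R^o V (fun c => c *: w)) (set_scale_subgroup _ _).
    exact: scalel_zmod_morphism.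
  move=> a b Aa Bb /=; rewrite -scalerA.
  by do 2![apply: set_scaleI => //].
apply: set_scale_sub => [|a v Aa]; first exact: set_scale_subgroup.
move: v; apply: (@set_scale_sub R V _ _ [set v | set_scale (@set_scale R R^o A B) W (a *: v)]).
  apply: (@subgroup_preim V V (fun v => a *: v)) (set_scale_subgroup _ _).
  exact: scaler_zmod_morphism.
move=> b w Bb Ww /=; rewrite scalerA; apply: set_scaleI => //.
exact: (@set_scaleI R R^o).
Qed.

Lemma finite_length_dcc (R : comNzRingType) (V : lmodType R) (W : set V) (A : nat -> set V) :
  finite_length_quotient W -> (forall t, submodule (A t)) ->
  (forall t, A t.+1 `<=` A t) -> (forall t, W `<=` A t) -> exists t, A t `<=` A t.+1.
Proof.
case=> n [C [C0 Cn sC simC]] sA Adec WA.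
have Amono t t' : (t <= t')%N -> A t' `<=` A t.
  move=> /subnK <-; elim: (t' - t)%N => [|p IH] v //=.
  by rewrite addSn => /Adec /IH.
(* Each [(A t `&` C i.+1) + C i] is [C i] or [C i.+1], and decreases with [t]. *)
pose B i t : set V := [set v | exists2 u, (A t `&` C i.+1) u & exists2 u', C i u' & v = u + u'].
have [t ht] : exists t, forall i : 'I_n, forall t', (t <= t')%N -> B i t' `<=` B i t'.+1.
  apply: uniform_bound => [i p q pq h t' qt'|[i ni] /=].
    by apply: h; apply: leq_trans qt'.
  have [[CC _] sim] := simC i ni.
  have hC := submodule_subgroup (sC i (ltnW ni)); have hC1 := submodule_subgroup (sC i.+1 ni).
  have hA t := submodule_subgroup (sA t).
  have Bsub t : B i t `<=` C i.+1.
    by move=> v [u [_ Cu] [u' Cu' ->]]; apply: subgroupD => //; apply: CC.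
  have CB t : C i `<=` B i t.
    move=> v Cv; exists 0; last by exists v; rewrite ?add0r.
    by split; apply: subgroup0.
  have BD t : B i t = C i \/ B i t = C i.+1.
    apply: sim => //; apply/submoduleP; split.
      by apply: subgroup_add => //; apply: subgroupI.
    move=> a v [u [Au Cu] [u' Cu' ->]]; exists (a *: u).
      by split; [apply: submoduleZ|apply: submoduleZ (sC _ ni) _].
    by exists (a *: u'); [apply: submoduleZ (sC _ (ltnW ni)) _|rewrite scalerDr].
  have [[t0 Bt0]|noC] := pselect (exists t, B i t = C i).
    exists t0 => t' tt' v [u [/(Amono _ _ tt') Au Cu] [u' Cu' vE]].
    by apply: CB; rewrite -Bt0; exists u => //; exists u'.
  exists 0%N => t' _; have [h|->] := BD t'.+1; last exact: Bsub.
  by case: noC; exists t'.+1.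
exists t; suff h i : (i <= n)%N -> A t `&` C i `<=` A t.+1.
  by move=> v Av; apply: (h n) => //; split; rewrite ?Cn.
(* Climbing the series: modulo C_i an element of A_t and C_(i+1) agrees with an element of A_(t+1),
   and the difference lies in A_t and C_i, where the induction hypothesis applies. *)
elim: i => [_ v [_]|i IH ni v [Av Cv]]; first by rewrite C0 => /WA.
have hC := submodule_subgroup (sC i (ltnW ni)); have hC1 := submodule_subgroup (sC i.+1 ni).
have hA := submodule_subgroup (sA _).
have [|u [Au Cu] [u' Cu' vE]] := ht (Ordinal ni) t (leqnn t) v.
  by exists v => //; exists 0; [apply: subgroup0|rewrite addr0].
rewrite vE; apply: subgroupD => //; apply: IH (ltnW ni) _ _; split => //.
have -> : u' = v - u by rewrite vE addrC addKr.
by apply: subgroupB => //; apply: Adec.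
Qed.

Section Power.
Variables (k : fieldType) (S : comAlgType k) (G : nat -> set S).
Variables (M : lmodType S) (D : int -> set M) (I F : set S) (d : nat).
Hypotheses (hS : standard_graded G) (hM : graded_module G D).
Hypotheses (hF : F `<=` G d) (hI : I = ideal_span F).
Let hG := std_grading hS.
Let hD := gmod_grading hM.
Local Notation xs := (irrelevant_gens G).
Local Notation Id := (I `&` G d).
Local Notation PM := (power_module D I).

Let hDs j : subgroup (D j) := grading_subgroup hD j.

Lemma component_scale i j a v : G i a ->
  component hD j (a *: v) = a *: component hD (j - i%:Z) v.
Proof.
move=> Ga.
rewrite -{1}[j](subrK i%:Z) addrC.
rewrite (@component_image _ _ _ _ _ _ hD hD (fun v => a *: v) (fun j => i%:Z + j)) //.
- exact: scaler_zmod_morphism.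
- by move=> l w; apply: (gmod_scale hM).
- by move=> x y /addrI.
Qed.

(** The generators of [I] lie in I_d, and their coefficients from [S] are absorbed by the submodule
    [W]. *)
Lemma set_scale_ideal (W : set M) : submodule W -> set_scale I W = set_scale Id W.
Proof.
move=> sW; apply/seteqP; split; last by apply: set_scaleS => // ? [].
apply: set_scale_sub => [|a w]; first exact: set_scale_subgroup.
rewrite {1}hI => + Ww; move: a.
apply: (@submodule_span_sub S S^o _ [set a | set_scale Id W (a *: w)]).
  apply/submoduleP; split.
    apply: (@subgroup_preim S M (fun c => c *: w)) (set_scale_subgroup _ _).
    exact: scalel_zmod_morphism.
  move=> a b /= h; rewrite -[_ *: w]/((a * b) *: w) -scalerA.
  exact: submoduleZ (set_scale_submodule _ sW) h.
move=> f Ff; apply: set_scaleI => //; split; last exact: hF.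
by rewrite hI; apply: (@sub_submodule_span S S^o).
Qed.

Definition ideal_module m : set M := set_scale (ideal_pow I m) [set: M].

Lemma ideal_module0 : ideal_module 0 = [set: M].
Proof.
by apply/seteqP; split=> // v _; rewrite -(scale1r v); apply: set_scaleI.
Qed.

Lemma ideal_module_submodule m : submodule (ideal_module m).
Proof. exact: set_scale_submodule (submoduleT _). Qed.

Lemma ideal_moduleS m : ideal_module m.+1 = set_scale Id (ideal_module m).
Proof.
by rewrite -set_scale_ideal /ideal_module /= ?set_scaleA //; apply: ideal_module_submodule.
Qed.

Lemma ideal_module1 : ideal_module 1 = set_scale I [set: M].
Proof. by rewrite ideal_moduleS ideal_module0 -set_scale_ideal //; apply: submoduleT. Qed.

Lemma ideal_module_component m j v : ideal_module m v -> ideal_module m (component hD j v).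
Proof.
elim: m j v => [|m IH] j; first by rewrite ideal_module0.
rewrite ideal_moduleS.
apply: (@set_scale_sub S M _ _ [set v | set_scale Id (ideal_module m) (component hD j v)]).
  by apply: subgroup_preim (set_scale_subgroup _ _); apply: component_zmod_morphism.
move=> a w [Ia Ga] hw /=; rewrite (component_scale _ _ Ga).
by apply: set_scaleI => //; apply: IH.
Qed.

Lemma power_module0 j : PM 0 j = D j.
Proof. by rewrite /power_module -/(ideal_module 0) ideal_module0 setTI. Qed.

Lemma power_module_subgroup m j : subgroup (PM m j).
Proof. by apply: subgroupI => //; apply: submodule_subgroup (ideal_module_submodule m). Qed.

Lemma power_module_sub m j : PM m j `<=` D j.
Proof. exact: subIsetr. Qed.

Lemma power_module_scale m i j a v : G i a -> PM m j v -> PM m (i%:Z + j) (a *: v).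
Proof.
move=> Ga [hv Dv]; split; last exact: (gmod_scale hM).
exact: submoduleZ (ideal_module_submodule m) hv.
Qed.

(** For [a] in I_d, the component of degree [j] of [a *: w] involves only the component of [w] of
    degree j - d, which stays in I^m M because I^m M is homogeneous. Iteration gives (I^m M)_(m d +
    e) = I_d^m M_e. *)
Lemma power_moduleS m j : PM m.+1 j = set_scale Id (PM m (j - d%:Z)).
Proof.
apply/seteqP; split.
  move=> v [hv Dv]; rewrite -(component_id hD Dv).
  have {Dv}hv : set_scale Id (ideal_module m) v by rewrite -ideal_moduleS.
  move: v hv.
  apply: (@set_scale_sub S M _ _ [set v | set_scale Id (PM m (j - d%:Z)) (component hD j v)]).
    by apply: subgroup_preim (set_scale_subgroup _ _); apply: component_zmod_morphism.
  move=> a w Ia hw; rewrite /= (component_scale _ _ Ia.2); apply: set_scaleI => //.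
  by split; [apply: ideal_module_component|apply: component_in].
apply: set_scale_sub => [|a w [Ia Ga] [hw Dw]]; first exact: power_module_subgroup.
split; last by rewrite -[j](subrK d%:Z) addrC; apply: (gmod_scale hM).
by rewrite -/(ideal_module _) ideal_moduleS; apply: set_scaleI.
Qed.

Variable g : int.
Hypothesis hg : submodule_span (D g) = [set: M].

Lemma component_scale_out j a v : D g v -> j < g -> component hD j (a *: v) = 0.
Proof.
move=> Dv jg; apply: (@component_out _ _ _ _ _ _ hG hD (fun a => a *: v) (fun i => i%:Z + g)).
- exact: scalel_zmod_morphism.
- by move=> i b Gb; apply: (gmod_scale hM).
- by move=> i; apply/eqP; lia.
Qed.

Lemma degree_lt j : j < g -> D j `<=` [set 0].
Proof.
move=> jg v Dv /=; rewrite -(component_id hD Dv).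
have : submodule_span (D g) v by rewrite hg.
suff : submodule_span (D g) `<=` [set v | forall a, component hD j (a *: v) = 0].
  by move=> h /h /(_ 1); rewrite scale1r.
apply: submodule_span_sub => [|w Dw a]; last exact: component_scale_out.
apply/submoduleP; split; first split.
- by move=> a; rewrite scaler0 component0.
- by move=> u w hu hw a; rewrite scalerBr component_zmod_morphism hu hw subrr.
- by move=> a w hw b; rewrite scalerA.
Qed.

Lemma degree_ge (n : nat) : D (g + n%:Z) `<=` set_scale (G n) (D g).
Proof.
move=> v Dv /=; rewrite -(component_id hD Dv).
have : submodule_span (D g) v by rewrite hg.
suff : submodule_span (D g) `<=`
    [set v | forall a, set_scale (G n) (D g) (component hD (g + n%:Z) (a *: v))].
  by move=> h /h /(_ 1); rewrite scale1r.
have hs := set_scale_subgroup (G n) (D g).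
apply: submodule_span_sub => [|w Dw a /=].
  apply/submoduleP; split; first split.
  - by move=> a; rewrite scaler0 component0; apply: subgroup0.
  - move=> u w hu hw a; rewrite scalerBr component_zmod_morphism.
    exact: subgroupB (hu a) (hw a).
  - by move=> a w hw b; rewrite scalerA.
rewrite addrC.
rewrite (@component_image _ _ _ _ _ _ hG hD (fun a => a *: w) (fun i => i%:Z + g)).
- by apply: set_scaleI => //; apply: component_in.
- exact: scalel_zmod_morphism.
- by move=> i b Gb; apply: (gmod_scale hM).
- by move=> x y /addIr[].
Qed.

Lemma degree_succ j : g <= j -> D (j + 1) `<=` set_scale [set` xs] (D j).
Proof.
move=> gj; have [n ->] : exists n : nat, j = g + n%:Z by exists `|j - g|%N; lia.
rewrite -addrA -PoszD addn1 => v /degree_ge hv.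
suff : set_scale [set` xs] (set_scale (G n) (D g)) v.
  apply: set_scaleS => //; apply: set_scale_sub => // a w Ga Dw.
  by rewrite addrC; apply: (gmod_scale hM).
rewrite -set_scaleA; apply: set_scaleS hv => //; exact: graded_succ.
Qed.

(** From degree [g] on M_(j+1) = S_1 M_j, so an equality M_j = (I^m M)_j in one degree persists in
    all higher ones. *)
Lemma power_module_degree_up m j i : g <= j -> j <= i -> D j `<=` PM m j -> D i `<=` PM m i.
Proof.
move=> gj ji h; have [n ->] : exists n : nat, i = j + n%:Z by exists `|i - j|%N; lia.
elim: n => [|n IH]; first by rewrite addr0.
rewrite -addn1 PoszD addrA => v /degree_succ hv.
have {}hv := hv (ler_wpDr (isT : 0 <= n%:Z) gj); move: v hv.
apply: set_scale_sub => [|x w xx /IH hw]; first exact: power_module_subgroup.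
rewrite addrC; apply: power_module_scale hw.
by apply: (standard_irrelevant_gens hS).1.
Qed.

Hypothesis hMI : finite_length_quotient (set_scale I [set: M]).

Lemma power_module_cofinite m : exists q : int, forall j, q <= j -> D j `<=` PM m j.
Proof.
have [q hq] : exists q : int, forall j, q <= j -> D j `<=` PM 1 j.
  (* The submodule of elements whose components below degree g + t lie in IM. It contains IM and
     decreases with [t], and an inclusion of [A t] in [A t.+1] says that M_(g + t) lies in IM. *)
  pose A t : set M := [set v | forall j, j < g + t%:Z -> ideal_module 1 (component hD j v)].
  have hT := submodule_subgroup (ideal_module_submodule 1).
  have [|||t At] := finite_length_dcc (A := A) hMI.
  - move=> t; apply/submoduleP; split; first split.
    + by move=> j _; rewrite component0; apply: subgroup0.
    + by move=> u v hu hv j jt; rewrite component_zmod_morphism; apply: subgroupB (hu j jt) (hv j jt).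
    + move=> a v hv j jt; have [s [_ _ ->]] := component_sum hG a.
      rewrite scaler_suml (zmod_morphism_sum (component_zmod_morphism hD j)).
      apply: subgroup_sum => // i _; rewrite (component_scale _ _ (component_in hG i a)).
      by apply: submoduleZ (ideal_module_submodule 1) _; apply: hv; lia.
  - by move=> t v hv j jt; apply: hv; lia.
  - by move=> t v hv j _; apply: ideal_module_component; rewrite ideal_module1.
  exists (g + t%:Z) => j tj; apply: (@power_module_degree_up 1 (g + t%:Z)) => //; first by lia.
  move=> v Dv; split=> //; rewrite -/(ideal_module 1) -(component_id hD Dv).
  apply: At; last by lia.
  move=> i it; rewrite (component_homog hD _ Dv).
  by case: eqP => [e|_]; [lia|apply: subgroup0].
elim: m => [|m [p IH]]; first by exists 0 => j _; rewrite power_module0.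
(* Here M_j = (IM)_j = I_d M_(j - d), and M_(j - d) = (I^m M)_(j - d) by induction. *)
exists (Num.max q (p + d%:Z)) => j; rewrite ge_max => /andP[/hq qj pj] v /qj.
rewrite !power_moduleS; apply: set_scaleS => // w [_ Dw]; apply: IH => //; lia.
Qed.

End Power.

(** * The algebra k[I_d t] and the components of N_e *)

Section Fiber.
Variables (k : fieldType) (S : comAlgType k) (G : nat -> set S).
Variables (M : lmodType S) (D : int -> set M) (I F : set S) (d : nat).
Hypotheses (hS : standard_graded G) (hM : graded_module G D).
Hypotheses (hF : F `<=` G d) (hI : I = ideal_span F).
Let hG := std_grading hS.
Let hD := gmod_grading hM.
Local Notation Id := (I `&` G d).
Local Notation PM := (power_module D I).
Local Notation A := (fiber_ring G I d).
Local Notation An := (fiber_ring_grading G I d).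

Lemma fiber_ring_closed : [/\ A 1, subgroup A, forall p q, A p -> A q -> A (p * q)
  & (range (fun c : k => (c%:A)%:P) `|` [set f *: 'X | f in Id]) `<=` A].
Proof. exact: subring_span_closed. Qed.

Lemma fiber_ring_coef p : A p -> forall n, monomial_span Id n p`_n.
Proof.
have hE := monomial_span_subgroup Id.
move: p; apply: (@subring_span_sub _ _ [set p : {poly S} | forall n, monomial_span Id n p`_n]).
- move=> n; rewrite coef1; case: n => [|n]; last exact: subgroup0.
  by exists 1; rewrite ?scale1r.
- split=> [n|u v hu hv n]; first by rewrite coef0; apply: subgroup0.
  by rewrite coefB; apply: subgroupB.
- move=> u v hu hv n; rewrite coefM; apply: subgroup_sum => // i _.
  rewrite -{1}(subnKC (ltn_ord i : (i <= n)%N)).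
  exact: monomial_spanM.
- move=> _ [[c _ <-] n|[f Idf <-] n].
    by rewrite coefC; case: n => [|n] /=; [exists c|apply: subgroup0 (hE n.+1)].
  rewrite /= coefZ coefX; have [->|n1] := eqVneq n 1%N.
    by rewrite mulr1; apply: monomial_span1.
  by rewrite mulr0; apply: subgroup0.
Qed.

Lemma scaleXM (f b : S) n : (f *: 'X) * (b *: 'X^n) = (f * b) *: 'X^(n.+1) :> {poly S}.
Proof. by rewrite -scalerAl -scalerAr scalerA exprS. Qed.

Lemma fiber_ring_monomial n a : monomial_span Id n a -> An n (a *: 'X^n).
Proof.
have [_ hA AM AX] := fiber_ring_closed.
move=> ha; split; last by move=> l ln; rewrite coefZ coefXn (negbTE ln) mulr0.
elim: n a ha => [_ [c _ <-]|n IH].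
  by rewrite expr0 alg_polyC; apply: AX; left; exists c.
apply: (@set_scale_sub S S^o _ _ [set a | A (a *: 'X^(n.+1))]).
  apply: (@subgroup_preim S {poly S} (fun a => a *: 'X^(n.+1))) => // u v.
  by rewrite scalerBl.
move=> f b If hb; rewrite /= -[f *: b]/(f * b) -scaleXM.
by apply: AM; [apply: AX; right; exists f|apply: IH].
Qed.

Lemma fiber_ring_total n a : monomial_span Id n a -> graded_total An (a *: 'X^n).
Proof. by move=> ha; apply: sub_additive_span; exists n; apply: fiber_ring_monomial. Qed.

Lemma fiber_ring_gradingE n p : An n p -> p = p`_n *: 'X^n.
Proof.
move=> [_ p0]; apply/polyP => l; rewrite coefZ coefXn.
by case: eqP => [->|/eqP ln]; rewrite ?mulr1 // mulr0 p0.
Qed.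

Lemma ideal_degree_subspace : @linear_subspace k S Id.
Proof.
have sI : @submodule S S^o I by rewrite hI; apply: submodule_span_submodule.
have hIs := submodule_subgroup sI.
split; first exact: subgroupI hIs (grading_subgroup hG d).
move=> c v [Iv Gv]; split; last exact: (graded_scale hS).
by rewrite -mulr_algl; exact: (@submoduleZ S S^o I c%:A v sI Iv).
Qed.

Lemma fiber_irrelevant_gens_ex : exists ys : seq {poly S},
  (forall y, y \in ys -> An 1 y) /\
  @set_scale {poly S} {poly S}^o (graded_total An) [set` ys] = irrelevant_ideal An.
Proof.
have [gs hgs] := graded_finitely_spanned hS d.
have [fs fsI Ifs] := subspace_finitely_spanned ideal_degree_subspace
  (subset_trans (@subIsetr _ _ _) hgs).
have ys1 y : y \in [seq f *: 'X | f <- fs] -> An 1 y.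
  case/mapP => f /fsI If ->; rewrite -['X]expr1; apply: fiber_ring_monomial.
  exact: monomial_span1.
exists [seq f *: 'X | f <- fs]; split=> //; apply/seteqP; split.
  apply: set_scale_sub => [|a y]; first exact: additive_span_subgroup.
  move=> + /= yfs; move: a; apply: (@additive_span_sub _ _ [set a | irrelevant_ideal An (a *: y)]).
    apply: (@subgroup_preim {poly S} {poly S} (fun a => a * y)).
      by move=> u v; rewrite mulrBl.
    exact: additive_span_subgroup.
  move=> p [n Ap] /=; have [f /fsI If yE] := mapP yfs.
  apply: sub_additive_span; exists n.+1 => //.
  rewrite (fiber_ring_gradingE Ap) yE /GRing.scale /= mulrC scaleXM.
  apply: fiber_ring_monomial; apply: (@set_scaleI S S^o) => //.
  exact: fiber_ring_coef Ap.1 n.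
apply: additive_span_sub => [|p [[//|n] _ Ap]]; first exact: set_scale_subgroup.
rewrite (fiber_ring_gradingE Ap); set B := set_scale _ _.
move: p`_n.+1 (fiber_ring_coef Ap.1 n.+1) => a; move: a {p Ap}.
have hB : subgroup B := set_scale_subgroup _ _.
apply: (@set_scale_sub S S^o _ _ [set a | B (a *: 'X^(n.+1))]).
  apply: (@subgroup_preim S {poly S} (fun a => a *: 'X^(n.+1))) => // u v.
  by rewrite scalerBl.
move=> f b /Ifs + hb; move: f b hb.
suff : lspan fs `<=`
    [set f | forall b, monomial_span Id n b -> B ((f * b) *: 'X^(n.+1))].
  by move=> h f b hb /h; apply.
apply: lspan_sub; first split; first split.
- by move=> b hb; rewrite mul0r scale0r; apply: subgroup0.
- move=> u v hu hv b hb; rewrite mulrBl scalerBl.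
  exact: subgroupB (hu b hb) (hv b hb).
- move=> c f hf b hb; rewrite -scalerAl scalerAr; apply: hf.
  exact: (monomial_span_subspace Id n).2.
- move=> f ffs b hb; rewrite -scaleXM mulrC.
  apply: (@set_scaleI {poly S} {poly S}^o); first exact: fiber_ring_total.
  by apply/mapP; exists f.
Qed.

(** Every element of degree one of k[I_d t] is f t with f in I_d, whatever system was chosen.
    Comparing coefficients of t shows that the chosen f generate I_d over [S]. *)
Lemma fiber_irrelevant_gens : exists fs : seq S,
  [/\ irrelevant_gens An = [seq f *: 'X | f <- fs], forall f, f \in fs -> Id f
    & Id `<=` @set_scale S S^o [set: S] [set` fs]].
Proof.
have [ys1 E] : (forall y, y \in irrelevant_gens An -> An 1 y) /\
    @set_scale {poly S} {poly S}^o (graded_total An) [set` irrelevant_gens An] =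
    irrelevant_ideal An.
  rewrite /irrelevant_gens; case: xgetP => [ys _ //|noys].
  by have [ys hys] := fiber_irrelevant_gens_ex; case: (noys ys).
move: ys1 E; set ys := irrelevant_gens An => ys1 E.
have ysE y : y \in ys -> y = y`_1 *: 'X by move=> /ys1 /fiber_ring_gradingE; rewrite expr1.
exists [seq y`_1 | y : {poly S} <- ys]; split.
- rewrite -map_comp -[LHS]map_id; apply/eq_in_map => y; exact: ysE.
- move=> _ /mapP[y /ys1[/fiber_ring_coef/(_ 1%N) + _] ->].
  move: y`_1; apply: (@set_scale_sub S S^o); first by case: ideal_degree_subspace.
  move=> f _ If [c _ <-]; rewrite -[_ *: _]/(f * _) mulr_algr.
  exact: ideal_degree_subspace.2.
- move=> f If.
  have : irrelevant_ideal An (f *: 'X).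
    apply: sub_additive_span; exists 1%N => //.
    by rewrite -['X]expr1; apply: fiber_ring_monomial; apply: monomial_span1.
  rewrite -E; set B := set_scale [set: S] _.
  suff h : set_scale (graded_total An) ([set` ys] : set {poly S}^o) `<=` [set p | B p`_1].
    by move=> /h; rewrite /= coefZ coefX mulr1.
  apply: set_scale_sub => [|a y _ /= yys].
    apply: (@subgroup_preim {poly S} S (fun p => p`_1)); last exact: set_scale_subgroup.
    by move=> u v; rewrite coefB.
  rewrite (ysE y yys) -[_ *: _]/(a * _) -scalerAr coefZ coefMX /= mulrC.
  by apply: (@set_scaleI S S^o) => //=; apply: map_f.
Qed.

Definition pm_monomial (n : nat) (v : M) : poly_module M.
Proof.
exists (fun i => if i == n then v else 0); exists n.+1 => i ni.
by case: eqP ni => // ->; rewrite ltnn.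
Defined.

Lemma scaleX_pm (f : S) (u : poly_module M) i :
  ((f *: 'X : {poly S}) *: u) i = if i is j.+1 then f *: u j else 0.
Proof.
rewrite /GRing.scale /=; case: i => [|i].
  by rewrite big_ord1 coefZ coefX mulr0 scale0r.
rewrite (bigD1 (lift ord0 ord0)) //= coefZ coefX mulr1 subSS subn0 big1 ?addr0 //.
move=> j j1; rewrite coefZ coefX; case: eqP => [e|_]; last by rewrite mulr0 scale0r.
by case/negP: j1; apply/eqP/val_inj.
Qed.

(** [power_moduleS] identifies I_d^n M_e with (I^n M)_(n d + e). Through this lemma the cohomology
    of N_e can be compared with the powers inside M. *)
Lemma fiber_moduleP (e : int) (n : nat) (u : poly_module M) :
  fiber_module G D I d e n%:Z u <->
  PM n ((n * d)%N%:Z + e) (u n) /\ forall l, l != n -> u l = 0.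
Proof.
have eE m : (m.+1 * d)%N%:Z + e - d%:Z = (m * d)%N%:Z + e by rewrite mulSn; lia.
split=> [[hu un]|[un u0]].
  split; last by move=> l ln; apply: un; apply/eqP => -[le]; rewrite le eqxx in ln.
  move: u hu {un}.
  apply: (@set_scale_sub _ _ _ _
    [set u : poly_module M | PM n ((n * d)%N%:Z + e) (u n)]).
    by apply: (@subgroup_preim (poly_module M) M (fun u => u n)) => //;
      apply: (power_module_subgroup I hM).
  move=> p w /fiber_ring_coef/(_ n) hp [Dw w0] /=.
  rewrite big_ord_recr /= subnn big1 ?add0r; last first.
    by move=> j _; rewrite w0 ?scaler0 // subn_gt0.
  elim: n p`_n hp => [|n IH] a.
    by case=> c _ <-; rewrite mul0n add0r power_module0 // -(add0r e);
      apply: (gmod_scale hM) => //; apply: graded_scalar.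
  move: a; apply: (@set_scale_sub S S^o _ _
    [set a | PM n.+1 ((n.+1 * d)%N%:Z + e) (a *: w 0%N)]).
    apply: (@subgroup_preim S M (fun a => a *: w 0%N)); last exact: (power_module_subgroup I hM).
    exact: scalel_zmod_morphism.
  move=> f b If /IH hb; rewrite /= -[f *: b]/(f * b) -scalerA (power_moduleS hM hF hI).
  by apply: set_scaleI => //; rewrite eE.
split; last by move=> l ln; apply: u0; apply: contra_neq ln => ->.
have -> : u = pm_monomial n (u n).
  by apply: pm_ext => i /=; case: eqP => [->|/eqP /u0].
move: (u n) un => v {u u0}.
set W := [set u : poly_module M | _]; set B := set_scale A W.
have hB : subgroup B := set_scale_subgroup _ _.
have BA a w : A a -> B w -> B (a *: w).
  move=> Aa; move: w; apply: (@set_scale_sub _ _ _ _ [set w | B (a *: w)]).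
    by apply: (@subgroup_preim _ _ (fun w : poly_module M => a *: w)) => //;
      apply: scaler_zmod_morphism.
  move=> b w Ab Ww /=; rewrite scalerA; apply: set_scaleI => //.
  by case: fiber_ring_closed => _ _ AM _; apply: AM.
elim: n v => [|n IH] v.
  rewrite mul0n add0r power_module0 // => Dv.
  rewrite -[pm_monomial _ _]scale1r; apply: set_scaleI; first by case: fiber_ring_closed.
  by split=> // -[].
rewrite (power_moduleS hM hF hI) eE.
move: v; apply: (@set_scale_sub _ _ _ _ [set v | B (pm_monomial n.+1 v)]).
  apply: (@subgroup_preim _ _ (pm_monomial n.+1)) => // u v; apply: pm_ext => i /=.
  by case: eqP; rewrite ?subrr.
move=> f w If /IH hw /=.
have -> : pm_monomial n.+1 (f *: w) = (f *: 'X : {poly S}) *: pm_monomial n w.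
  apply: pm_ext => i; rewrite scaleX_pm /=; case: i => // i; rewrite eqSS.
  by case: eqP; rewrite ?scaler0.
by apply: BA => //; case: fiber_ring_closed => _ _ _; apply; right; exists f.
Qed.

End Fiber.

(** * Radicals and change of generators *)

Section Radical.
Variable R : comNzRingType.
Implicit Types K J : set R.

Definition is_ideal J := @submodule R R^o J.

Lemma idealMl J a b : is_ideal J -> J b -> J (a * b).
Proof. by move=> /(@submoduleZ R R^o J a b). Qed.

Lemma ideal_subgroup J : is_ideal J -> subgroup J.
Proof. exact: (@submodule_subgroup R R^o). Qed.

Lemma idealP J : subgroup J -> (forall a b, J b -> J (a * b)) -> is_ideal J.
Proof. by move=> hJ JM; apply/(@submoduleP R R^o). Qed.

Definition radical K : set R := [set a | exists n, K (a ^+ n)].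

Lemma radical_ideal K : is_ideal K -> is_ideal (radical K).
Proof.
move=> iK; have hK := ideal_subgroup iK.
have up a n m : K (a ^+ n) -> (n <= m)%N -> K (a ^+ m).
  by move=> Ka nm; rewrite -(subnK nm) exprD; apply: idealMl.
apply: idealP => [|a b [n Kb]]; last by exists n; rewrite exprMn; apply: idealMl.
split; first by exists 1%N; rewrite expr1; apply: subgroup0.
move=> a b [n Ka] [m Kb]; exists (n + m)%N; rewrite exprDn.
apply: subgroup_sum => // i _; rewrite -mulr_natl; apply: idealMl => //.
have [/(up _ _ _ Kb) h|mi] := leqP m i.
  by rewrite exprNn; do 2!apply: idealMl => //.
by rewrite mulrC; apply: idealMl => //; apply: up Ka _; lia.
Qed.

Lemma radical_exp K a n : radical K (a ^+ n) -> radical K a.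
Proof. by case=> m; rewrite -exprM; exists (n * m)%N. Qed.

Lemma ideal_gens_sub J (X : set R) : is_ideal J -> X `<=` J ->
  @set_scale R R^o [set: R] X `<=` J.
Proof.
move=> iJ XJ; apply: (@set_scale_sub R R^o); first exact: ideal_subgroup.
by move=> a x _ /XJ; apply: idealMl.
Qed.

Lemma det_congr J n (A B : 'M[R]_n) : is_ideal J ->
  (forall i j, J (A i j - B i j)) -> J (\det A - \det B).
Proof.
move=> iJ AB; have hJ := ideal_subgroup iJ.
rewrite /determinant -sumrB; apply: subgroup_sum => // s _.
rewrite -mulrBr; apply: idealMl => //.
apply: (@big_ind2 _ _ (fun a b => J (a - b))) => //.
  by rewrite subrr; apply: subgroup0.
move=> a a' b b' Ja Jb.
have -> : a * b - a' * b' = a * (b - b') + b' * (a - a').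
  by rewrite !mulrBr [b' * a]mulrC [b' * a']mulrC addrA subrK.
by apply: subgroupD => //; apply: idealMl.
Qed.

Section Module.
Variables (V : lmodType R) (vs : seq V).
Hypothesis hvs : submodule_span [set` vs] = [set: V].

Lemma ideal_scale_coord J v : is_ideal J -> set_scale J [set: V] v ->
  exists c : 'I_(size vs) -> R, (forall i, J (c i)) /\ v = \sum_i c i *: vs`_i.
Proof.
move=> iJ; have hJ := ideal_subgroup iJ; move: v.
apply: (@set_scale_sub R V _ _ [set v | exists c : 'I_(size vs) -> R,
  (forall i, J (c i)) /\ v = \sum_i c i *: vs`_i]).
  split.
    exists (fun=> 0); split=> [i|]; first exact: subgroup0.
    by rewrite big1 // => i _; rewrite scale0r.
  move=> u v [c [Jc ->]] [c' [Jc' ->]]; exists (fun i => c i - c' i); split.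
    by move=> i; apply: subgroupB.
  by rewrite -sumrB; apply: eq_bigr => i _; rewrite scalerBl.
move=> a w Ja _ /=.
have [c ->] : exists c : 'I_(size vs) -> R, w = \sum_i c i *: vs`_i.
  have : submodule_span [set` vs] w by rewrite hvs.
  move: w; apply: (@submodule_span_sub R V _ [set w | exists c : 'I_(size vs) -> R,
    w = \sum_i c i *: vs`_i]).
    apply/submoduleP; split; first split.
    - by exists (fun=> 0); rewrite big1 // => i _; rewrite scale0r.
    - move=> u v [c ->] [c' ->]; exists (fun i => c i - c' i).
      by rewrite -sumrB; apply: eq_bigr => i _; rewrite scalerBl.
    - move=> b v [c ->]; exists (fun i => b * c i).
      by rewrite scaler_sumr; apply: eq_bigr => i _; rewrite scalerA.
  move=> v /= vvs; have vl : (index v vs < size vs)%N by rewrite index_mem.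
  exists (fun i => (i == Ordinal vl)%:R).
  rewrite (bigD1 (Ordinal vl)) //= eqxx scale1r nth_index // big1 ?addr0 // => i ne.
  by rewrite (negbTE ne) scale0r.
exists (fun i => c i * a); split=> [i|]; first exact: idealMl.
by rewrite scaler_sumr; apply: eq_bigr => i _; rewrite scalerA mulrC.
Qed.

(** The determinant trick. *)
Lemma exp_mod_annihilator J a : is_ideal J -> (forall v, set_scale J [set: V] (a *: v)) ->
  exists2 b, J b & forall v : V, (a ^+ size vs - b) *: v = 0.
Proof.
move=> iJ aV; have hJ := ideal_subgroup iJ.
have /choice[c hc] : forall i : 'I_(size vs), exists c : 'I_(size vs) -> R,
    (forall j, J (c j)) /\ a *: vs`_i = \sum_j c j *: vs`_j.
  by move=> i; apply: ideal_scale_coord.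
pose C := \matrix_(i, j) c i j; pose B := a%:M - C.
have BV i : \sum_j B i j *: vs`_j = 0.
  have -> : \sum_j B i j *: vs`_j = \sum_j (a%:M i j *: vs`_j) - \sum_j C i j *: vs`_j.
    by rewrite -sumrB; apply: eq_bigr => j _; rewrite -scalerBl !mxE.
  rewrite (bigD1 i) //= mxE eqxx mulr1n big1 ?addr0.
    under [X in _ - X]eq_bigr do rewrite mxE.
    by have [_ <-] := hc i; rewrite subrr.
  by move=> j ji; rewrite mxE eq_sym (negbTE ji) scale0r.
have detB l : \det B *: vs`_(l : 'I_(size vs)) = 0.
  transitivity (\sum_j (\adj B *m B) l j *: vs`_j).
    rewrite mul_adj_mx (bigD1 l) //= mxE eqxx mulr1n big1 ?addr0 // => j jl.
    by rewrite mxE eq_sym (negbTE jl) scale0r.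
  under eq_bigr do rewrite mxE scaler_suml.
  rewrite exchange_big big1 // => i _.
  under eq_bigr do rewrite -scalerA.
  by rewrite -scaler_sumr BV scaler0.
exists (a ^+ size vs - \det B).
  rewrite -(det_scalar _ a); apply: det_congr => // i j.
  by rewrite /B !mxE subKr; have [] := hc i.
move=> v; rewrite subKr.
have : submodule_span [set` vs] v by rewrite hvs.
move: v; apply: (@submodule_span_sub R V _ [set v | \det B *: v = 0]).
  apply/submoduleP; split; first split; first exact: scaler0.
    by move=> u v /= hu hv; rewrite scalerBr hu hv subrr.
  by move=> b v /= hv; rewrite scalerA mulrC -scalerA hv scaler0.
move=> v /= vvs; have vl : (index v vs < size vs)%N by rewrite index_mem.
by have := detB (Ordinal vl); rewrite /= nth_index.
Qed.

End Module.

Lemma annihilator_ideal (V : lmodType R) (w : V) : is_ideal [set a | a *: w = 0].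
Proof.
apply: idealP; first split; first exact: scale0r.
  by move=> a b /= ha hb; rewrite scalerBl ha hb subrr.
by move=> a b /= hb; rewrite -scalerA hb scaler0.
Qed.

Lemma torsion_submodule (V : lmodType R) (xs : seq R) : submodule (@torsion R V xs).
Proof.
apply/submoduleP; split; first split.
- by move=> l; exists 0%N; rewrite scaler0.
- move=> u v hu hv l; have [p hp] := hu l; have [q hq] := hv l.
  exists (p + q)%N; rewrite scalerBr (expZ_le0 (leq_addr q p) hp).
  by rewrite (expZ_le0 (leq_addl p q) hq) subrr.
- move=> a v hv l; have [p hp] := hv l; exists p.
  by rewrite scalerA mulrC -scalerA hp scaler0.
Qed.

Lemma torsionP (V : lmodType R) (xs : seq R) (w : V) :
  torsion xs w <-> (forall x, x \in xs -> radical [set a | a *: w = 0] x).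
Proof.
split=> [h x xx|h l]; last exact: h (mem_nth _ _).
have xl : (index x xs < size xs)%N by rewrite index_mem.
by have [p] := h (Ordinal xl); rewrite /= nth_index //; exists p.
Qed.

End Radical.

(** * Local cohomology of the powers and of the fiber module *)

Section Core.
Variables (k : fieldType) (S : comAlgType k) (G : nat -> set S).
Variables (M : lmodType S) (D : int -> set M) (I F : set S) (d : nat).
Hypotheses (hS : standard_graded G) (hM : graded_module G D).
Hypotheses (hF : F `<=` G d) (hI : I = ideal_span F).
Variable g : int.
Hypotheses (hg : submodule_span (D g) = [set: M]).
Hypothesis hMI : finite_length_quotient (set_scale I [set: M]).
Let hG := std_grading hS.
Let hD := gmod_grading hM.
Local Notation xs := (irrelevant_gens G).
Local Notation Id := (I `&` G d).
Local Notation PM := (power_module D I).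
Local Notation LC := (local_cohomology_neq0 G).

Let xs1 x : x \in xs -> G 1%N x. Proof. exact: (standard_irrelevant_gens hS).1. Qed.

Let xsn (l : 'I_(size xs)) : G 1%N xs`_l. Proof. by apply/xs1/mem_nth. Qed.

Definition regularity_le (N : int -> set M) (z : int) :=
  forall i j, LC N i j -> i%:Z + j <= z.

Lemma zero_regularity_le (N : int -> set M) z : (forall i, subgroup (N i)) ->
  (forall i, N i `<=` [set 0]) -> regularity_le N z.
Proof.
move=> hN N0 i l [n [c [hc _ []]]].
exists 0%N, (fun=> 0); split=> [_ s _|s /hc /N0 ->]; first exact: subgroup0.
by exists 0%N; rewrite /cech_d big1 ?scaler0 ?subrr ?scaler0 // => x _; rewrite scaler0.
Qed.

Lemma power_module_cofinal m : cofinal xs (PM m) D.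
Proof.
split.
- by move=> j v l hv; rewrite addrC; apply: (power_module_scale hM).
- exact: power_module_sub.
- move=> j; have [q hq] := power_module_cofinite hS hM hF hI hg hMI m.
  exists `|q - j|%N => p v l hp Dv; apply: hq; first by lia.
  rewrite addrC -[p in p%:Z]muln1; apply: (gmod_scale hM) => //.
  exact: graded_exp.
Qed.

Lemma torsion_degree_eq0 j v : ~ LC D 0 j -> D j v -> torsion xs v -> v = 0.
Proof.
move=> h Dv tv; apply: contrapT => /eqP v0; apply: h.
by apply/cech_cohomology0P; exists v.
Qed.

Lemma torsion_sub_eq j v w : ~ LC D 0 j -> D j v -> D j w -> torsion xs (v - w) -> v = w.
Proof.
move=> h Dv Dw tvw; apply/eqP; rewrite -subr_eq0; apply/eqP.
exact: torsion_degree_eq0 h (subgroupB (grading_subgroup hD j) Dv Dw) tvw.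
Qed.

(** By the exact sequence H^0(M) -> M / I^m M -> H^1(I^m M) -> H^1(M), this is injectivity of the
    last map in degree [j]. *)
Definition covers m j := forall v, D j v -> exists2 w, PM m j w & torsion xs (v - w).

Lemma cohomology1_covers m j : ~ LC (PM m) 1 j -> covers m j.
Proof.
move=> /cech_cohomology1P h v Dv.
have [sP PD ev] := power_module_cofinal m.
have [n hn] := ev j.
(* For this [n] the fraction x_l^n v / x_l^n is a section of I^m M over each localization; the
   element glued from them differs from [v] by torsion. *)
have [|l l'|w Pw hw] := h n (fun l => xs`_l ^+ n *: v).
- by move=> l; apply: hn.
- by exists 0%N; rewrite !scalerA [xs`_l' ^+ n * _]mulrC subrr scaler0.
- exists w => // l; have [p hp] := hw l; exists (p + n)%N.
  by rewrite exprD -scalerA scalerBr -opprB scalerN hp oppr0.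
Qed.

(** The sections glue in M, and changing the result by torsion to land in I^m M does not affect its
    images in the localizations. *)
Lemma covers_cohomology1 m j : ~ LC D 1 j -> covers m j -> ~ LC (PM m) 1 j.
Proof.
move=> /cech_cohomology1P h cv; apply/cech_cohomology1P => n u Pu cu.
have [|//|v Dv hv] := h n u; first by move=> l; apply: power_module_sub (Pu l).
have [w Pw tw] := cv v Dv; exists w => // l.
have [p hp] := hv l; have [q hq] := tw l; exists (p + q)%N.
have -> : xs`_l ^+ n *: w - u l = xs`_l ^+ n *: v - u l - xs`_l ^+ n *: (v - w).
  by rewrite scalerBr opprB [RHS]addrC addrA subrK.
rewrite scalerBr (expZ_le0 (leq_addr q p) hp) scalerA mulrC -scalerA.
by rewrite (expZ_le0 (leq_addl p q) hq) scaler0 subrr.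
Qed.

Lemma regularity_le_covers m (a : int) : regularity_le (PM m) ((m * d)%N%:Z + a) ->
  forall j, (m * d)%N%:Z + a <= j -> covers m j.
Proof. by move=> h j mj; apply: cohomology1_covers => /h; lia. Qed.

(** H^i(I^m M) embeds in H^i(M) for i = 0 and for i >= 2. A class of H^1 in degree [j] counts as 1 +
    j in the regularity, so covering is needed from j = z on. *)
Lemma covers_regularity_le m z : regularity_le D z ->
  (forall j, z <= j -> covers m j) -> regularity_le (PM m) z.
Proof.
move=> hz cv [|[|i]] j hij.
- apply: hz; have /cech_cohomology0P[v [Pv v0 tv]] := hij.
  by apply/cech_cohomology0P; exists v; split=> //; apply: power_module_sub Pv.
- have [h|nh] := pselect (LC D 1 j); first exact: hz.
  rewrite leNgt; apply/negP => zj.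
  by apply: (covers_cohomology1 nh) hij; apply: cv; lia.
- by apply: hz; apply: cech_cohomology_sub (power_module_cofinal m) _ hij.
Qed.

(** Bounds reg M by the regularity of one power: above degree [q] the torsion of M lies in I^m M,
    and the higher cohomology of M is a quotient of that of I^m M. *)
Lemma regularity_le_module m z : regularity_le (PM m) z -> exists z', regularity_le D z'.
Proof.
move=> hz; have [q hq] := power_module_cofinite hS hM hF hI hg hMI m.
exists (Num.max z q) => -[|i] j hij; rewrite le_max.
  have [jq|qj] := leP j q; first by rewrite add0r jq orbT.
  apply/orP; left; apply: hz; have /cech_cohomology0P[v [Dv v0 tv]] := hij.
  by apply/cech_cohomology0P; exists v; split=> //; apply: hq => //; apply: ltW.
by apply/orP; left; apply: hz; apply: cech_cohomology_cofinal (power_module_cofinal m) _ hij.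
Qed.

(** This is where [m >= 1] enters: for [j >= m d + a], up to torsion,
    [M_j = I_d^m M_(j - m d)] is contained in [I_d M_(j - d)]. *)
Lemma covers_propagate m n (a : int) : (0 < m)%N -> (m <= n)%N ->
  (forall j, (m * d)%N%:Z + a <= j -> covers m j) ->
  forall j, (n * d)%N%:Z + a <= j -> covers n j.
Proof.
case: m => // m _ mn cm; rewrite -(subnK mn); elim: (n - m.+1)%N => [//|p IH] j.
rewrite addSn; set q := (p + m.+1)%N in IH * => hj v Dv.
have hT := submodule_subgroup (torsion_submodule M xs).
have [|w Pw tw] := cm j _ v Dv.
  by apply: le_trans hj; rewrite /q; lia.
suff [w' Pw' tw'] : exists2 w', PM q.+1 j w' & torsion xs (w - w').
  exists w' => //; have -> : v - w' = (v - w) + (w - w') by rewrite subrKA.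
  exact: (subgroupD hT).
move: Pw; rewrite (power_moduleS hM hF hI) => hw; move: w hw {tw}.
apply: (@set_scale_sub S M _ _ [set w | exists2 w', PM q.+1 j w' & torsion xs (w - w')]).
  split; first by exists 0; [apply: subgroup0 (power_module_subgroup I hM _ _)
    |rewrite subrr; apply: (subgroup0 hT)].
  move=> u w [u' Pu' tu] [w' Pw' tw]; exists (u' - w').
    exact: subgroupB (power_module_subgroup I hM _ _) _ _ Pu' Pw'.
  have -> : u - w - (u' - w') = (u - u') - (w - w').
    by rewrite !opprB addrACA [RHS]addrACA; congr (_ + _); exact: addrC.
  exact: (subgroupB hT).
move=> f u If [_ Du] /=.
have [|w' Pw' tw'] := IH (j - d%:Z) _ u Du; first by move: hj; rewrite mulSn; lia.
exists (f *: w'); first by rewrite (power_moduleS hM hF hI); apply: set_scaleI.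
by rewrite -scalerBr; apply: submoduleZ (torsion_submodule M xs) tw'.
Qed.

Lemma power_module_lt m i : i < (m * d)%N%:Z + g -> PM m i `<=` [set 0].
Proof.
elim: m i => [|m IH] i hi.
  by rewrite power_module0; apply: (degree_lt hS hM hg); lia.
rewrite (power_moduleS hM hF hI); apply: (@set_scale_sub S M _ _ [set 0]).
  by split=> // u v -> ->; rewrite subrr.
move=> a w _ /IH; rewrite /= => ->; first by rewrite scaler0.
by move: hi; rewrite mulSn; lia.
Qed.

(** * Torsion and gluing: from generators of I_d to generators of S_+ *)

Hypothesis d0 : (0 < d)%N.
Variable fs : seq S.
Hypothesis fsI : forall f, f \in fs -> Id f.
Hypothesis fsgen : Id `<=` @set_scale S S^o [set: S] [set` fs].

Lemma ideal_sub_gens : I `<=` @set_scale S S^o [set: S] [set` fs].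
Proof.
rewrite hI; apply: (@submodule_span_sub S S^o).
  exact: (@set_scale_submodulel S S^o [set: S] _ (submoduleT S^o)).
move=> f Ff; apply: fsgen; split; last exact: hF.
by rewrite hI; apply: (@sub_submodule_span S S^o).
Qed.

Hypothesis hfg : finitely_generated M.

(** A power of [x] maps M into IM, so the determinant trick puts a further power into [I] modulo the
    annihilator of M, and [I] lies in the radical of [K]. For torsion [K] is the annihilator of one
    element; for gluing it consists of the scalars that act on M as combinations of powers of the
    f. *)
Lemma irrelevant_radical (K : set S) x : is_ideal K ->
  (forall a, (forall v : M, a *: v = 0) -> K a) -> (forall f, f \in fs -> radical K f) ->
  G 1%N x -> radical K x.
Proof.
move=> iK annK fsK Gx; have [vs hvs] := hfg.
have iR := radical_ideal iK; have hR := ideal_subgroup iR.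
have iI : is_ideal I by rewrite hI; apply: (@submodule_span_submodule S S^o).
have [q hq] := power_module_cofinite hS hM hF hI hg hMI 1.
(* M starts in degree [g], so multiplication by x^N brings every component to degree at least [q],
   where M and IM agree. *)
pose N := `|q - g|%N.
have xI v : set_scale I [set: M] (x ^+ N *: v).
  have [s [_ _ ->]] := component_sum hD v; rewrite scaler_sumr.
  apply: subgroup_sum => [|j _]; first exact: set_scale_subgroup.
  have [jg|gj] := ltP j g.
    have -> : component hD j v = 0 by apply: (degree_lt hS hM hg jg); apply: component_in.
    by rewrite scaler0; apply: subgroup0 (set_scale_subgroup _ _).
  rewrite -(ideal_module1 M hF hI); apply: (hq (N%:Z + j) _ _ _).1; first by lia.
  rewrite -[N in N%:Z]muln1; apply: (gmod_scale hM); last exact: component_in.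
  exact: graded_exp.
have [b Ib hb] := exp_mod_annihilator hvs iI xI.
apply: (@radical_exp _ _ _ N); apply: (@radical_exp _ _ _ (size vs)).
rewrite -[_ ^+ size vs](subrK b); apply: subgroupD => //.
  by exists 1%N; rewrite expr1; apply: annK.
by apply: (ideal_gens_sub iR fsK); apply: ideal_sub_gens.
Qed.

Lemma torsion_gens_irrelevant (w : M) : torsion fs w -> torsion xs w.
Proof.
move=> /torsionP h; apply/torsionP => x /xs1 Gx.
apply: irrelevant_radical => //; first exact: annihilator_ideal.
by move=> a; apply.
Qed.

Lemma torsion_irrelevant_gens (w : M) : torsion xs w -> torsion fs w.
Proof.
move=> /torsionP h; apply/torsionP => f /fsI[_ Gf].
have : irrelevant_ideal G f by apply: sub_additive_span; exists d.
rewrite -(standard_irrelevant_gens hS).2; apply: ideal_gens_sub => //.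
exact/radical_ideal/annihilator_ideal.
Qed.

Lemma scaler_comm (a b : S) (v : M) : a *: (b *: v) = b *: (a *: v).
Proof. by rewrite !scalerA mulrC. Qed.

Definition gens_glue j := forall p (w : 'I_(size fs) -> M),
  (forall l, D ((p * d)%N%:Z + j) (w l)) ->
  (forall l l' : 'I_(size fs), exists q,
    (fs`_l * fs`_l') ^+ q *: (fs`_l ^+ p *: w l' - fs`_l' ^+ p *: w l) = 0) ->
  exists2 v, D j v & forall l : 'I_(size fs), exists q, fs`_l ^+ q *: (fs`_l ^+ p *: v - w l) = 0.

(** Sections over the complement of V(I_d) extend if sections over the complement
    of V(S_+) do: a power of each [x] in [xs] is an [S]-combination of the
    [f ^+ P], modulo the annihilator of [M]. *)
Lemma glues_gens_glue j : glues xs D j -> gens_glue j.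
Proof.
move=> gl p w Dw cw.
have Gf (l : 'I_(size fs)) : G d fs`_l by apply: (fsI (mem_nth _ _)).2.
(* A common exponent [Q] absorbs the torsion in the cocycle condition: the scaled numerators f_l^Q
   w_l satisfy it exactly, by [w'E]. *)
have [Q hQ] : exists Q, forall ll : 'I_(size fs) * 'I_(size fs), true ->
    (fs`_ll.1 * fs`_ll.2) ^+ Q *: (fs`_ll.1 ^+ p *: w ll.2 - fs`_ll.2 ^+ p *: w ll.1) = 0.
  by apply: torsion_uniform => -[l l'] _; apply: cw.
pose P := (p + Q)%N; pose w' (l : 'I_(size fs)) := fs`_l ^+ Q *: w l.
have w'E (l l' : 'I_(size fs)) : fs`_l ^+ P *: w' l' = fs`_l' ^+ P *: w' l.
  apply/eqP; rewrite -subr_eq0 -(hQ (l, l') isT) /= scalerBr !scalerA; apply/eqP.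
  congr (_ *: _ - _ *: _); rewrite /P exprMn exprD [RHS]mulrC -mulrA //.
  by congr (_ * _); rewrite mulrC.
have Dw' l : D ((P * d)%N%:Z + j) (w' l).
  have -> : (P * d)%N%:Z + j = (Q * d)%N%:Z + ((p * d)%N%:Z + j) by rewrite /P mulnDl; lia.
  by apply: (gmod_scale hM) => //; apply: graded_exp.
pose K := [set a : S | exists b : 'I_(size fs) -> S,
  forall v : M, a *: v = \sum_l (b l * fs`_l ^+ P) *: v].
have iK : is_ideal K.
  apply: idealP; first split.
  - by exists (fun=> 0) => v; rewrite scale0r big1 // => l _; rewrite mul0r scale0r.
  - move=> a a' [b hb] [b' hb']; exists (fun l => b l - b' l) => v.
    rewrite scalerBl hb hb' -sumrB; apply: eq_bigr => l _.
    by rewrite mulrBl scalerBl.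
  - move=> a a' [b hb]; exists (fun l => a * b l) => v.
    rewrite -scalerA hb scaler_sumr; apply: eq_bigr => l _.
    by rewrite scalerA mulrA.
have Kx x : G 1%N x -> radical K x.
  apply: irrelevant_radical => // [a ha|f /(nthP 0)[i il <-]].
    by exists (fun=> 0) => v; rewrite ha big1 // => l _; rewrite mul0r scale0r.
  exists P, (fun l => (l == Ordinal il)%:R) => v.
  rewrite (bigD1 (Ordinal il)) //= eqxx mul1r big1 ?addr0 // => l li.
  by rewrite (negbTE li) mul0r scale0r.
have [N hN] : exists N, forall h : 'I_(size xs), K (xs`_h ^+ N).
  apply: uniform_bound => [h q q' qq' Kq|h]; last exact: Kx.
  by rewrite -(subnK qq') exprD; apply: idealMl.
have [b hb] := choice hN.
(* The section to be glued over the localization at x_h is v_h / x_h^N. Since x_h^N acts as the sum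
   of the b_l f_l^P, the exact cocycle condition gives f_l^P v_h = x_h^N w'_l. The coefficients b_l
   need not be homogeneous, hence the component of degree N + j. *)
pose v (h : 'I_(size xs)) := component hD (N%:Z + j) (\sum_l b h l *: w' l).
have GN h : G N (xs`_(h : 'I_(size xs)) ^+ N).
  by rewrite -[N in G N]muln1; apply: graded_exp.
have fv h (l : 'I_(size fs)) : fs`_l ^+ P *: v h = xs`_h ^+ N *: w' l.
  have <- : component hD ((P * d)%N%:Z + (N%:Z + j)) (xs`_h ^+ N *: w' l) = xs`_h ^+ N *: w' l.
    by apply: component_id; rewrite addrCA; apply: (gmod_scale hM).
  have <- : fs`_l ^+ P *: (\sum_l b h l *: w' l) = xs`_h ^+ N *: w' l.
    rewrite hb scaler_sumr; apply: eq_bigr => l' _.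
    by rewrite scaler_comm w'E scalerA.
  rewrite (component_scale hM _ _ (graded_exp hS P (Gf l))).
  by rewrite [_ + (_ + _)]addrC addrK.
have [|h h'|u Du hu] := gl N v.
- by move=> h; rewrite addrC; apply: component_in.
- have : torsion xs (xs`_h ^+ N *: v h' - xs`_h' ^+ N *: v h).
    apply: torsion_gens_irrelevant => l; exists P.
    rewrite scalerBr [fs`_l ^+ P *: _]scaler_comm fv.
    by rewrite [fs`_l ^+ P *: _]scaler_comm fv scaler_comm subrr.
  by move=> /(_ h)[q hq]; exists q; rewrite exprMn mulrC -scalerA hq scaler0.
exists u => // l.
(* The equality of [u] with w'_l / f_l^P is checked over the localizations at the x_h, as torsion
   for [xs] is torsion for [fs]. *)
have : torsion fs (fs`_l ^+ P *: u - w' l).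
  apply: torsion_irrelevant_gens => h; have [q hq] := hu h; exists (q + N)%N.
  rewrite exprD -scalerA scalerBr [xs`_h ^+ N *: _]scaler_comm -fv -scalerBr.
  by rewrite scaler_comm hq scaler0.
move=> /(_ l)[q hq]; exists (q + Q)%N; rewrite -hq exprD -scalerA; congr (_ *: _).
by rewrite scalerBr scalerA -exprD addnC.
Qed.

(** * H^1(N_e)_n against M_(n d + e) / I_d^n M_e *)

Lemma scaleXn_pm (f : S) p (u : poly_module M) i :
  ((f *: 'X : {poly S}) ^+ p *: u) i = if (p <= i)%N then f ^+ p *: u (i - p)%N else 0.
Proof.
elim: p i => [|p IH] i; first by rewrite expr0 !scale1r subn0.
rewrite exprS -scalerA scaleX_pm; case: i => [//|i]; rewrite IH ltnS subSS.
by case: ifP; rewrite ?scaler0 // exprS scalerA.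
Qed.

Lemma congr_pm (u v : poly_module M) : u = v -> forall i, u i = v i.
Proof. by move->. Qed.

Lemma pm_coefB (u v : poly_module M) i : (u - v) i = u i - v i.
Proof. by []. Qed.

Variable e : int.
Local Notation N := (fiber_module G D I d e).
Local Notation ys := [seq f *: 'X : {poly S} | f <- fs].

Lemma nth_gens (l : nat) : (l < size ys)%N -> ys`_l = fs`_l *: 'X.
Proof. by rewrite size_map => lf; rewrite (nth_map 0). Qed.

(** Over each localization v t^n is f_l^P v t^(n+P) / (f_l t)^P, and f_l^P v has degree (n + P) d +
    e, where M agrees with I^(n+P) M. So v t^n is a section of N_e. Gluing puts [v] into I^n M up to
    torsion, and M has none in degree n d + e. *)
Lemma fiber_glues_sub n : ~ LC D 0 ((n * d)%N%:Z + e) ->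
  (exists P : nat, forall p, (P <= p)%N ->
    D ((p * d)%N%:Z + e) `<=` PM p ((p * d)%N%:Z + e)) ->
  glues ys N n%:Z -> D ((n * d)%N%:Z + e) `<=` PM n ((n * d)%N%:Z + e).
Proof.
move=> h0 [P hP] gl v Dv.
have [||V /(fiber_moduleP hS hM hF hI)[PV V0] hV] :=
  gl P (fun l => pm_monomial (n + P) (fs`_l ^+ P *: v)).
- move=> l; rewrite -PoszD; apply/(fiber_moduleP hS hM hF hI); split; last first.
    by move=> i /= /negbTE ->.
  rewrite /= eqxx; apply: hP; first exact: leq_addl.
  rewrite mulnDl addnC PoszD -addrA; apply: (gmod_scale hM) => //; apply: (graded_exp hS).
  by apply: (fsI (mem_nth _ _)).2; rewrite -(size_map (fun f => f *: 'X : {poly S})).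
- move=> l l'; exists 0%N; rewrite expr0 scale1r; apply: pm_ext => i.
  rewrite !nth_gens // pm_coefB !scaleXn_pm.
  case: ifP => _; last by rewrite subr0.
  by rewrite /=; case: eqP => _; rewrite ?scaler0 ?subr0 // scaler_comm subrr.
- have DV := power_module_sub PV.
  suff -> : v = V n by [].
  apply: torsion_sub_eq h0 Dv DV _; apply: torsion_gens_irrelevant => l.
  have ly : (l < size ys)%N by rewrite size_map.
  have [q hq] := hV (Ordinal ly); exists (q + P)%N.
  have := congr_pm hq (q + (P + n))%N.
  rewrite nth_gens // scaleXn_pm leq_addr addKn pm_coefB scaleXn_pm leq_addr addKn.
  rewrite /= addnC eqxx => h.
  by rewrite exprD -scalerA scalerBr -opprB scalerN h oppr0.
Qed.

(** Sections of N_e in degree n are sections of M in degree n d + e. They glue in M, and the assumed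
    inclusion puts the glued element into N_e. *)
Lemma fiber_sub_glues n : gens_glue ((n * d)%N%:Z + e) ->
  D ((n * d)%N%:Z + e) `<=` PM n ((n * d)%N%:Z + e) -> glues ys N n%:Z.
Proof.
move=> gl DP p u Nu cu.
have syf : size fs = size ys by rewrite size_map.
pose cst := cast_ord syf.
have Nu' l : PM (n + p) (((n + p) * d)%N%:Z + e) (u l (n + p)%N) /\
    forall i, i != (n + p)%N -> u l i = 0.
  by apply/(fiber_moduleP hS hM hF hI); rewrite PoszD.
have [l|l l'|v Dv hv] := gl p (fun l => u (cst l) (n + p)%N).
- have := power_module_sub (Nu' (cst l)).1.
  by rewrite mulnDl addnC PoszD -addrA.
- have [q hq] := cu (cst l) (cst l'); exists q.
  have := congr_pm hq (q + (q + (p + (n + p))))%N.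
  rewrite exprMn -scalerA !nth_gens // scaleXn_pm leq_addr addKn scaleXn_pm leq_addr addKn.
  by rewrite pm_coefB !scaleXn_pm leq_addr addKn exprMn scalerA.
- exists (pm_monomial n v).
    apply/(fiber_moduleP hS hM hF hI); split; first by rewrite /= eqxx; apply: DP.
    by move=> l /= /negbTE ->.
  move=> l; have [q hq] := hv (cast_ord (esym syf) l); exists q; apply: pm_ext => i.
  rewrite nth_gens // scaleXn_pm; case: leqP => // qi; rewrite pm_coefB scaleXn_pm /=.
  have El : cst (cast_ord (esym syf) l) = l by apply: val_inj.
  rewrite El /= in hq.
  have [->|ne] := eqVneq (i - q)%N (n + p)%N.
    by rewrite leq_addl addnK eqxx hq.
  rewrite (Nu' l).2 // subr0; case: leqP => // pi; last by rewrite scaler0.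
  case: eqP => [en|_]; last by rewrite !scaler0.
  by case/eqP: ne; rewrite -en subnK.
Qed.

Lemma fiber_H1_sub n : regularity_le D ((n * d)%N%:Z + e - 1) ->
  (exists P : nat, forall p, (P <= p)%N -> regularity_le (PM p) ((p * d)%N%:Z + e)) ->
  glues ys N n%:Z -> D ((n * d)%N%:Z + e) `<=` PM n ((n * d)%N%:Z + e).
Proof.
move=> hD0 [P hP]; apply: fiber_glues_sub; first by move=> /hD0; lia.
(* Taking p >= n makes p d + e at least n d + e, so that M has no torsion in that degree. *)
exists (maxn P n) => p; rewrite geq_max => /andP[/hP pP np] v Dv.
have [w Pw tw] := regularity_le_covers pP (lexx _) Dv.
suff -> : v = w by [].
have npd : (n * d <= p * d)%N by rewrite leq_mul2r np orbT.
by apply: torsion_sub_eq Dv (power_module_sub Pw) tw => /hD0; lia.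
Qed.

(** The regularity of I^m M is used at [m] and propagated, while reg M has to be bounded only at
    [n]. This separation is what the second claim of the theorem relies on. *)
Lemma fiber_sub_H1 m n : (0 < m)%N -> (m <= n)%N ->
  regularity_le (PM m) ((m * d)%N%:Z + e) -> regularity_le D ((n * d)%N%:Z + e - 1) ->
  glues ys N n%:Z.
Proof.
move=> m0 mn hm hn; apply: fiber_sub_glues.
  by apply/glues_gens_glue/cech_cohomology1P => /hn; lia.
move=> v Dv.
have [w Pw tw] := covers_propagate m0 mn (regularity_le_covers hm) (lexx _) Dv.
suff -> : v = w by [].
by apply: torsion_sub_eq Dv (power_module_sub Pw) tw => /hn; lia.
Qed.

(** * The asymptotic constant [e] *)

Hypothesis he : exists m0, forall m, (m0 <= m)%N ->
  regularity_le (PM m) ((m * d)%N%:Z + e) /\ ~ regularity_le (PM m) ((m * d)%N%:Z + e - 1).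

Lemma regularity_le_eventually : exists n0, forall n, (n0 <= n)%N ->
  regularity_le D ((n * d)%N%:Z + e - 1).
Proof.
have [m0 hm0] := he; have [z hz] := regularity_le_module (hm0 m0 (leqnn _)).1.
exists `|(z - e + 1)%R|%N => n hn i j /hz.
have nd : (n <= n * d)%N by rewrite leq_pmulr.
by lia.
Qed.

(** I^n M starts in degree n d + g. If e < g, then (I^n M)_(n d + e) = 0, and for large n this
    forces M_(n d + e) = 0. Then M vanishes in all large degrees and I^m M = 0 for large m, against
    the choice of [e]. The inequality is what allows an equality in degree m d + e to be carried to
    higher degrees. *)
Lemma generator_degree_le : g <= e.
Proof.
rewrite leNgt; apply/negP => eg.
have [m0 hm0] := he; have [n0 hn0] := regularity_le_eventually.
pose n := (m0 + n0 + `|g - e|)%N; pose j := (n * d)%N%:Z + e.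
have nd : (n <= n * d)%N by rewrite leq_pmulr.
have gj : g <= j by rewrite /j /n in nd *; lia.
have Dj0 : D j `<=` [set 0].
  move=> v Dv.
  have n1 : (m0 <= n)%N by rewrite /n; lia.
  have [w Pw tw] := regularity_le_covers (hm0 n n1).1 (lexx _) Dv.
  have w0 : w = 0 by apply: (power_module_lt _ Pw); lia.
  rewrite w0 subr0 in tw; apply: (@torsion_degree_eq0 j) tw => //.
  have /hn0 h : (n0 <= n)%N by rewrite /n; lia.
  by move=> /h; rewrite /j; lia.
have Di0 i : j <= i -> D i `<=` [set 0].
  (* As M_j = 0, it lies in I^m M for every m, so M_i does too; this [m] makes I^m M start above
     degree [i]. *)
  move=> ji v Dv; pose m := `|(i - g + 1)%R|%N.
  have md : (m <= m * d)%N by rewrite leq_pmulr.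
  apply: (@power_module_lt m i); first by rewrite /m in md *; lia.
  apply: (@power_module_degree_up _ _ _ _ _ _ hS hM _ hg m j) => // w /Dj0 ->.
  exact: subgroup0 (power_module_subgroup I hM _ _).
pose m := (m0 + `|j - g|)%N; have [_] := hm0 m (leq_addr _ _); apply.
have md : (m <= m * d)%N by rewrite leq_pmulr.
have P0 i : PM m i `<=` [set 0].
  have [ji|ij] := leP j i; first by move=> v /power_module_sub; apply: Di0.
  by apply: power_module_lt; rewrite /m in md *; lia.
exact: zero_regularity_le (power_module_subgroup I hM m) P0.
Qed.

Lemma regularity_ge m : (0 < m)%N -> regularity_le D ((m * d)%N%:Z + e - 1) ->
  ~ regularity_le (PM m) ((m * d)%N%:Z + e - 1).
Proof.
move=> m_gt0 hm; rewrite -addrA => /regularity_le_covers cm.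
have [m0 hm0] := he; pose n := maxn m m0.
have [_] := hm0 n (leq_maxr _ _); apply.
have nd : (m * d <= n * d)%N by rewrite leq_mul2r leq_maxl orbT.
rewrite -addrA; apply: covers_regularity_le.
  by move=> i j /hm; lia.
exact: covers_propagate m_gt0 (leq_maxl _ _) cm.
Qed.

Lemma fiber_H1_regularity_le m : regularity_le D ((m * d)%N%:Z + e - 1) ->
  glues ys N m%:Z -> regularity_le (PM m) ((m * d)%N%:Z + e).
Proof.
move=> hm gl; have sub : D ((m * d)%N%:Z + e) `<=` PM m ((m * d)%N%:Z + e).
  by apply: fiber_H1_sub => //; have [m0 h] := he; exists m0 => p /h[].
apply: covers_regularity_le; first by move=> i j /hm; lia.
move=> j mj v Dv; exists v; last first.
  by rewrite subrr; apply: subgroup0 (submodule_subgroup (torsion_submodule M xs)).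
have ge := generator_degree_le.
by apply: (@power_module_degree_up _ _ _ _ _ _ hS hM _ hg m _ _ _ mj sub v Dv); lia.
Qed.

End Core.

(** * Regularity as an extended integer *)

Definition ext_int (x : \bar rat) := [\/ x = -oo%E, x = +oo%E | exists z : int, x = (z%:~R)%:E].

Lemma int_bounded_max (A : set int) (b : int) : A !=set0 -> (forall a, A a -> a <= b) ->
  exists2 z, A z & forall a, A a -> a <= z.
Proof.
move=> [a0 Aa0] hb; pose P n := `[< A (b - n%:Z) >].
have exP : exists n, P n.
  exists `|b - a0|%N; apply/asboolP; have := hb a0 Aa0 => h.
  by rewrite (_ : _ - _ = a0) //; lia.
case: (ex_minnP exP) => n /asboolP An nmin; exists (b - n%:Z) => // a Aa.
have /nmin : P `|b - a|%N.
  by apply/asboolP; have h := hb a Aa; rewrite (_ : _ - _ = a) //; lia.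
by have := hb a Aa; lia.
Qed.

(** Over [rat], [ereal_sup] is a supremum only for sets that have one. *)
Lemma ext_int_sup (B : set \bar rat) : (forall x, B x -> ext_int x) ->
  ubound B (ereal_sup B) /\ ext_int (ereal_sup B).
Proof.
move=> hB.
have [->|/set0P B0] := eqVneq B set0.
  by rewrite ereal_sup0; split; [move=> x []|constructor 1].
suff [x [sx hx]] : exists x, supremums B x /\ ext_int x.
  have -> : ereal_sup B = x.
    rewrite /ereal_sup /supremum; case: ifPn => [/eqP E|_].
      by move: B0; rewrite E => -[].
    by apply: xget_unique => // y sy; apply: (is_subset1_supremums sy sx).
  by case: sx.
pose A := [set z : int | B (z%:~R)%:E].
have [By|nBy] := pselect (B +oo%E).
  exists +oo%E; split; last by constructor 2.
  by split=> [x _|y /(_ _ By)]; rewrite ?leey.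
have hB' x : B x -> x = -oo%E \/ exists2 z, A z & x = (z%:~R)%:E.
  move=> Bx; case: (hB x Bx) => [|E|[z E]]; [by left|by case: nBy; rewrite -E|].
  by right; exists z; rewrite // /A /= -E.
have [A0|/set0P/negP] := pselect (A !=set0); last first.
  rewrite negbK => /eqP A0; exists -oo%E; split; last by constructor 1.
  split=> [x /hB'[->|[z Az]]|y _]; rewrite ?leNye //.
  by move: Az; rewrite A0.
have [[b hb]|nb] := pselect (exists b : int, forall a, A a -> a <= b).
  have [z Az zmax] := int_bounded_max A0 hb.
  exists (z%:~R)%:E; split; last by constructor 3; exists z.
  split=> [x /hB'[->|[a Aa ->]]|y /(_ _ Az)//]; rewrite ?leNye //.
  by rewrite lee_fin ler_int; apply: zmax.
exists +oo%E; split; last by constructor 2.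
split=> [x _|y hy]; rewrite ?leey //.
case: y hy => [r|_|hy]; rewrite ?lexx //.
  move=> hy; case: nb; exists (Num.floor r) => a /hy.
  by rewrite lee_fin -floor_ge_int.
by have [z /hy] := A0.
Qed.

Section Regularity.
Variables (R : comNzRingType) (G : nat -> set R) (V : lmodType R) (N : int -> set V).
Local Notation LC := (local_cohomology_neq0 G N).

Lemma reg_local_cohomology_ext_int i : ext_int (reg_local_cohomology G N i).
Proof. by apply: (ext_int_sup _).2 => _ [j _ <-]; constructor 3; exists j. Qed.

Lemma reg_local_cohomology_leP i (z : int) :
  (reg_local_cohomology G N i <= (z%:~R)%:E)%E <-> forall j, LC i j -> j <= z.
Proof.
split=> [h j hj|h].
  have ub : ubound [set (j%:~R : rat)%:E | j in LC i] (reg_local_cohomology G N i).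
    by apply: (ext_int_sup _).1 => _ [l _ <-]; constructor 3; exists l.
  rewrite -(ler_int rat) -lee_fin; apply: le_trans h.
  by apply: ub; exists j.
by apply: ge_ereal_sup => _ [j hj <-]; rewrite lee_fin ler_int; apply: h.
Qed.

Lemma reg_ext : ubound (range (fun i : nat => (reg_local_cohomology G N i + (i%:R)%:E)%E))
    (reg G N) /\ ext_int (reg G N).
Proof.
apply: ext_int_sup => _ [i _ <-]; case: (reg_local_cohomology_ext_int i) => [->|->|[z ->]].
- by constructor 1.
- by constructor 2.
- by constructor 3; exists (z + i%:Z); rewrite -EFinD intrD.
Qed.

Lemma reg_leP (z : int) :
  (reg G N <= (z%:~R)%:E)%E <-> forall i j, LC i j -> i%:Z + j <= z.
Proof.
have step i : (reg_local_cohomology G N i + (i%:R)%:E <= (z%:~R)%:E)%E <->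
    forall j, LC i j -> i%:Z + j <= z.
  rewrite -leeBrDr // -EFinB -[i%:R]/((i%:Z)%:~R) -intrB reg_local_cohomology_leP.
  by split=> h j /h; lia.
split=> [h i|h].
  by apply/step; apply: le_trans h; apply: reg_ext.1; exists i.
by apply: ge_ereal_sup => _ [i _ <-]; apply/step; apply: h.
Qed.

(** Integrality turns the failure of [x <= z - 1] into [z <= x]. The value -oo of a zero module is
    excluded in the same way. *)
Lemma ext_int_eq x (z : int) : ext_int x ->
  x = (z%:~R)%:E <-> (x <= (z%:~R)%:E)%E /\ ~ (x <= ((z - 1)%:~R)%:E)%E.
Proof.
move=> hx; split=> [->|[]].
  by split=> //; rewrite lee_fin ler_int; lia.
case: hx => [->|->|[y ->]] //; rewrite ?leNye //.
by rewrite !lee_fin !ler_int => yz /negP; rewrite -ltNge => zy; congr (_%:~R%:E); lia.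
Qed.

Lemma reg_eqP (z : int) : reg G N = (z%:~R)%:E <->
  (forall i j, LC i j -> i%:Z + j <= z) /\ ~ (forall i j, LC i j -> i%:Z + j <= z - 1).
Proof. by rewrite (ext_int_eq _ reg_ext.2) !reg_leP. Qed.

End Regularity.

(** * Ideals generated in degree zero *)

Section DegreeZero.
Variables (k : fieldType) (S : comAlgType k) (G : nat -> set S).
Variables (M : lmodType S) (D : int -> set M) (I F : set S).
Hypotheses (hS : standard_graded G) (hM : graded_module G D).
Hypotheses (hF : F `<=` G 0%N) (hI : I = ideal_span F).
Let hG := std_grading hS.
Let hD := gmod_grading hM.
Local Notation PM := (power_module D I).

Lemma degree0_zero m j : F `<=` [set 0] -> PM m.+1 j `<=` [set 0].
Proof.
move=> F0; rewrite (power_moduleS hM hF hI); apply: (@set_scale_sub S M _ _ [set 0]).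
  by split=> // u v -> ->; rewrite subrr.
have I0 : I `<=` [set 0].
  rewrite hI; apply: (@submodule_span_sub S S^o) => //; apply/(@submoduleP S S^o).
  split; first by split=> // u v -> ->; rewrite subrr.
  by move=> a v ->; exact: mulr0.
by move=> a w [/I0 -> _] _ /=; rewrite scale0r.
Qed.

Lemma degree0_unit : ~ F `<=` [set 0] -> I 1.
Proof.
move=> /existsNP[f /not_implyP[Ff /eqP f0]].
have := hF Ff; rewrite (std_deg0 hS) => -[c _ cf].
have c0 : c != 0 by apply: contra_neq f0 => c0; rewrite -cf c0 scale0r.
have -> : 1 = c^-1%:A * f by rewrite -cf mulr_algl scalerA mulVf // scale1r.
rewrite hI; apply: (@idealMl S (ideal_span F)); first exact: (@submodule_span_submodule S S^o).
exact: (@sub_submodule_span S S^o).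
Qed.

Lemma degree0_power m j : I 1 -> PM m j = D j.
Proof.
move=> I1; have G1 : G 0%N 1 by rewrite -(scale1r 1); apply: graded_scalar.
apply/seteqP; split; first exact: power_module_sub.
elim: m j => [|m IH] j v Dv; first by rewrite power_module0.
rewrite (power_moduleS hM hF hI) subr0 -(scale1r v).
by apply: set_scaleI => //; apply: IH.
Qed.

(** One of the f is an invertible scalar, so the section over its localization already is an element
    of M. Compatibility with it determines the other sections. *)
Lemma degree0_gens_glue (fs : seq S) j : I 1 -> (forall f, f \in fs -> (I `&` G 0%N) f) ->
  I `&` G 0%N `<=` @set_scale S S^o [set: S] [set` fs] -> gens_glue D 0 fs j.
Proof.
move=> I1 fsI fsgen p w Dw cw.
have G1 : G 0%N 1 by rewrite -(scale1r 1); apply: graded_scalar.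
have [l0 fl0] : exists l0 : 'I_(size fs), fs`_l0 != 0.
  apply: contrapT => /forallNP h.
  have fs0 : [set` fs] `<=` [set 0].
    move=> f /= /(nthP 0)[i il <-]; apply/eqP/negPn/negP.
    exact: (h (Ordinal il)).
  have : set_scale [set: S] ([set` fs] : set S^o) `<=` [set 0].
    apply: set_scale_sub; first by split=> // u v -> ->; rewrite subrr.
    by move=> a f _ /fs0 -> /=; rewrite scaler0.
  by move=> /(_ 1 (fsgen _ (conj I1 G1))) /eqP; rewrite oner_eq0.
have := (fsI _ (mem_nth 0 (ltn_ord l0))).2; rewrite (std_deg0 hS) => -[c _ cf].
have c0 : c != 0 by apply: contra_neq fl0 => c0; rewrite -cf c0 scale0r.
pose b : S := c^-1%:A.
have bf : b * fs`_l0 = 1 by rewrite -cf mulr_algl scalerA mulVf // scale1r.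
have cancel n (v : M) : b ^+ n *: (fs`_l0 ^+ n *: v) = v.
  by rewrite scalerA -exprMn bf expr1n scale1r.
exists (b ^+ p *: w l0).
  suff : D ((p * 0)%N%:Z + ((p * 0)%N%:Z + j)) (b ^+ p *: w l0) by rewrite !muln0 !add0r.
  apply: (gmod_scale hM) => //; exact: (graded_exp hS p (graded_scalar hS _)).
move=> l; have [q hq] := cw l l0; exists q.
have h1 : fs`_l ^+ q *: (fs`_l ^+ p *: w l0 - fs`_l0 ^+ p *: w l) = 0.
  by rewrite -[LHS](cancel q) [fs`_l0 ^+ q *: _]scalerA -exprMn [fs`_l0 * _]mulrC hq scaler0.
have -> : fs`_l ^+ p *: (b ^+ p *: w l0) - w l =
    b ^+ p *: (fs`_l ^+ p *: w l0 - fs`_l0 ^+ p *: w l).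
  by rewrite scalerBr cancel scaler_comm.
by rewrite scaler_comm h1 scaler0.
Qed.

End DegreeZero.

Theorem theorem1p1 (k : fieldType) (S : comAlgType k) (G : nat -> set S)
    (M : lmodType S) (D : int -> set M) (I F : set S) (d : nat) (e : int)
    (hS : standard_graded G)
    (hF : F `<=` G d) (hI : I = ideal_span F)
    (hM : graded_module G D)
    (hMfg : finitely_generated M)
    (hMgen : generated_in_single_degree D)
    (hMI : finite_length_quotient (set_scale I [set: M]))
    (he : exists m0 : nat, forall m : nat, (m0 <= m)%N ->
       reg G (power_module D I m) = ((m * d)%N%:R + e%:~R)%:E) :
  let regH1 :=
    reg_local_cohomology (fiber_ring_grading G I d) (fiber_module G D I d e) 1 in
  let bound := ((reg G D - (e%:~R)%:E + 1) * (d%:R^-1)%:E)%E in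
  (forall m : nat, (1 <= m)%N ->
     (Order.max (regH1 + 1) bound <= (m%:R)%:E)%E ->
     reg G (power_module D I m) = ((m * d)%N%:R + e%:~R)%:E) /\
  ((bound <= regH1)%E ->
   forall m : nat, (1 <= m)%N ->
     (reg G (power_module D I m) = ((m * d)%N%:R + e%:~R)%:E <->
      (regH1 + 1 <= (m%:R)%:E)%E)).
Proof.
move=> regH1 bound.
have [fs [ysE fsI fsgen]] := fiber_irrelevant_gens d hS hI.
have zE m : ((m * d)%N%:R + e%:~R : rat) = ((m * d)%N%:Z + e)%:~R by rewrite intrD.
have H1E n : local_cohomology_neq0 (fiber_ring_grading G I d) (fiber_module G D I d e) 1 n
    <-> ~ glues [seq f *: 'X : {poly S} | f <- fs] (fiber_module G D I d e) n.
  rewrite /local_cohomology_neq0 ysE; split=> [h /cech_cohomology1P|h]; first by apply.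
  by apply: contrapT => /cech_cohomology1P.
have H1le (z : int) : (regH1 + 1 <= ((z + 1)%:~R)%:E)%E <->
    forall n, ~ glues [seq f *: 'X : {poly S} | f <- fs] (fiber_module G D I d e) n -> n <= z.
  rewrite intrD EFinD leeD2rE // reg_local_cohomology_leP.
  by split=> h n /H1E; apply: h.
have [g hg] := hMgen.
have [d0|d_gt0] := posnP d.
  subst d.
  (* If [F] had no nonzero element, I^m M would vanish for m > 0 and have regularity -oo. *)
  have I1 : I 1.
    apply: (degree0_unit hS hF hI) => F0; have [m0 /(_ m0.+1 (leqnSn _))] := he.
    rewrite zE => /reg_eqP[_]; apply.
    apply: zero_regularity_le; first exact: (power_module_subgroup I hM).
    by move=> i; apply: (degree0_zero hM hF hI).
  have PE m : power_module D I m = D by apply/funext => j; apply: (degree0_power hS hM hF hI).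
  have regE m : reg G (power_module D I m) = ((m * 0)%N%:R + e%:~R)%:E.
    have [m0 /(_ m0 (leqnn _))] := he.
    by rewrite !PE !muln0.
  (* The inverse of 0 is 0 by convention, so [bound] is 0 and the second claim assumes [0 <= regH1].
     This is refuted by showing that H^1(N_e) vanishes in all degrees n >= 0. *)
  split=> [//|]; rewrite /bound invr0 mule0 => h m m1; split=> // _.
  suff h1 : (regH1 <= ((-1)%:~R)%:E)%E by have := le_trans h h1; rewrite lee_fin.
  apply/reg_local_cohomology_leP => n /H1E; apply: contra_notP => /negP; rewrite -ltNge => n0.
  have -> : n = `|n|%N by lia.
  apply: (fiber_sub_glues hS hM hF hI); last by rewrite (degree0_power hS hM hF hI).
  exact: (degree0_gens_glue hS hM I1 fsI fsgen).
have he' : exists m0, forall m, (m0 <= m)%N ->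
    regularity_le G (power_module D I m) ((m * d)%N%:Z + e) /\
    ~ regularity_le G (power_module D I m) ((m * d)%N%:Z + e - 1).
  have [m0 hm0] := he; exists m0 => m /hm0; rewrite zE => /reg_eqP h; exact: h.
(* Clearing the denominator gives reg M <= n d + e - 1. In particular H^0(M) and H^1(M) vanish in
   degree n d + e. *)
have bound_le n : (bound <= (n%:R)%:E)%E -> regularity_le G D ((n * d)%N%:Z + e - 1).
  move=> hb; apply/reg_leP; move: hb; rewrite /bound.
  case: (reg G D) => [r| |]; rewrite ?leNye //; last first.
    by rewrite !addye // gt0_mulye ?lte_fin ?invr_gt0 ?ltr0n // leye_eq.
  rewrite -EFinB -EFinD -EFinM !lee_fin ler_pdivrMr ?ltr0n // => h.
  by rewrite intrB intrD -pmulrn natrM; lra.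
have part1 m : (1 <= m)%N -> (Order.max (regH1 + 1) bound <= (m%:R)%:E)%E ->
    reg G (power_module D I m) = ((m * d)%N%:R + e%:~R)%:E.
  move=> m1; rewrite ge_max => /andP[hH /bound_le hb].
  rewrite zE; apply/reg_eqP; split; last exact: (regularity_ge hS hM hF hI hg hMI d_gt0 he').
  apply: (fiber_H1_regularity_le hS hM hF hI hg hMI d_gt0 fsI fsgen hMfg he' hb).
  apply: contrapT => /H1E/H1E.
  have /H1le h : (regH1 + 1 <= ((m%:Z - 1 + 1)%:~R)%:E)%E by rewrite subrK.
  by move=> /h; lia.
split=> // bH m m1; split=> [|hH]; last first.
  apply: part1 => //; rewrite ge_max hH /=; apply: le_trans bH _.
  by apply: le_trans hH; rewrite leeDl.
rewrite zE => /reg_eqP[hm _].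
rewrite -[m%:R](_ : (m%:Z - 1 + 1)%:~R = _); last by rewrite subrK.
apply/H1le => n hn; rewrite leNgt; apply/negP => mn.
have van j : (m <= j)%N -> regularity_le G D ((j * d)%N%:Z + e - 1) ->
    glues [seq f *: 'X : {poly S} | f <- fs] (fiber_module G D I d e) j%:Z.
  by move=> mj; apply: (fiber_sub_H1 hS hM hF hI hg hMI d_gt0 fsI fsgen hMfg m1 mj).
have [n0 hn0] := regularity_le_eventually hS hM hF hI hg hMI d_gt0 he'.
(* Degrees from [m] on in which H^1(N_e) is nonzero. They are bounded, because [van] applies to all
   large degrees. *)
pose A := [set n : int | m%:Z <= n /\
  ~ glues [seq f *: 'X : {poly S} | f <- fs] (fiber_module G D I d e) n].
have [z [mz hz] zmax] : exists2 z, A z & forall a, A a -> a <= z.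
  apply: (@int_bounded_max A n0%:Z); first by exists n; split=> //; lia.
  move=> a [ma ha]; rewrite leNgt; apply/negP => na; apply: ha.
  have -> : a = `|a|%N by lia.
  by apply: van; [lia|apply: hn0; lia].
have Ez : z = `|z|%N by lia.
(* By maximality [z] is the top degree of H^1(N_e), so [bound <= regH1 <= z]. This bounds reg M at
   [z], as [van] requires, although no such bound is known at [m]. *)
apply: hz; rewrite Ez; apply: van; first by lia.
apply: bound_le; apply: le_trans bH _.
rewrite -[`|z|%N%:R]/((`|z|%N%:Z)%:~R) -Ez; apply/reg_local_cohomology_leP => l /H1E hl.
by have [lm|ml] := ltP l m%:Z; [lia|apply: zmax].
Qed.
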